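(* Let $n\ge 1$ and $m\ge 0$ be integers, and let $\mathcal B_V$ be the boundary cone of strip-concave trapezoidal arrays of size $(n,m)$. For $I\subseteq\{1,\ldots,n\}$ and $J\subseteq\{1,\ldots,m\}$ consider the inequality $$\lambda[1,|I|]+\lambda(J+|I|)-\bar\lambda(J)+\mu(I)-\nu(I)\ge 0. \qquad ( * )$$ Inequality $( * )$ determines a facet of $\mathcal B_V$ if and only if $0<|I|+|J|<n+m$ and either (i) $|I|\ne 0,n$ (and $J$ is arbitrary), or (ii) $|I|=0$ and $|J|=1$, or (iii) $|I|=n$ and $|J|=m-1$. Furthermore, all these facets are different, and $\mathcal B_V$ has no other facets if $n=1$ or if $n=2$ and $m=0$. Otherwise the remaining facets are exactly those determined by the chamber inequalities $\lambda_j\ge\lambda_{j+1}$ for $j=1,\ldots,n+m-1$, and $\bar\lambda_{j'}\ge\bar\lambda_{j'+1}$ for $j'=1,\ldots,m-1$. In particular, $\mathcal B_V$ has $(2^n-2)2^m+n+4m-2$ facets in case $n\ge 2$, and $2m$ facets in case $n=1$.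
   Context: Trapezoidal arrays. For integers $n\ge 1$, $m\ge 0$ let $V=\{(i,j)\in\mathbb Z^2: 0\le i\le n,\ 0\le j\le i+m\}$. A trapezoidal array of size $(n,m)$ is a real array $X=(x_{ij})_{(i,j)\in V}\in\mathbb R^V$. Its row derivative is given by $\partial x_{ij}:=x_{ij}-x_{i,j-1}$ for $0\le i\le n$, $1\le j\le i+m$. The array $X$ is strip-concave if for all $i=1,\ldots,n$: $\partial x_{ij}\ge \partial x_{i-1,j}$ for $1\le j\le i-1+m$, and $\partial x_{i-1,j}\ge\partial x_{i,j+1}$ for $1\le j\le i+m-1$. $\mathcal{SC}_V$ denotes the set of strip-concave arrays $X\in\mathbb R^V$ with the normalization $x_{00}=0$. Boundary tuples of $X$: $\lambda^X_j:=\partial x_{nj}$ ($j=1,\ldots,n+m$), $\bar\lambda^X_j:=\partial x_{0j}$ ($j=1,\ldots,m$; empty if $m=0$), $\mu^X_i:=x_{i0}-x_{i-1,0}$ and $\nu^X_i:=x_{i,i+m}-x_{i-1,i-1+m}$ ($i=1,\ldots,n$). The boundary cone $\mathcal B_V\subset\mathbb R^{n+m}\times\mathbb R^m\times\mathbb R^n\times\mathbb R^n$ is the set of all quadruples $(\lambda,\bar\lambda,\mu,\nu)$ such that $(\lambda,\bar\lambda,\mu,\nu)=(\lambda^X,\bar\lambda^X,\mu^X,\nu^X)$ for some $X\in\mathcal{SC}_V$; it is a polyhedral cone (not full-dimensional: it lies in the hyperplane $|\lambda|-|\bar\lambda|+|\mu|-|\nu|=0$, where $|d|$ is the sum of the entries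 of $d$). All inequalities $( * )$ and all chamber inequalities are valid for $\mathcal B_V$. A valid inequality determines a facet if the set of points of $\mathcal B_V$ at which it holds with equality is a face of dimension $\dim\mathcal B_V-1$. Notation: for a tuple $d$, $d(S):=\sum_{i\in S}d_i$ and $d[k,k']:=d_k+\cdots+d_{k'}$ (so $\lambda[1,0]=0$); $J+k:=\{j+k:j\in J\}$.
   Formalization: The printed count (2^n-2)2^m+n+4m-2 is off by one when m=0 and n≥3 (n=3, m=0: 6 facets from ( * ) and 2 chamber facets, 8 and not 7); in that case the number of facets is stated as (2^n-2)+(n-1). All else is as printed. *)

(* Defs.v *)
(* MathComp, with the real numbers and sets of MathComp-Analysis. *)
From HB Require Import structures.
From mathcomp Require Import all_boot all_order all_algebra.
From mathcomp Require Import classical_sets cardinality reals.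
Set Implicit Arguments.
Unset Strict Implicit.
Unset Printing Implicit Defensive.
Import Order.TTheory GRing.Theory Num.Theory.
Local Open Scope ring_scope.
Local Open Scope classical_set_scope.

Section Faces.
Variables (R : realType) (E : vectType R).
Implicit Types (S F : set E) (d : nat).

(* S contains d + 1 affinely independent points. *)
Definition affdim_ge S d : Prop :=
  exists (p : E) (q : d.-tuple E),
    [/\ S p, (forall i, S (tnth q i)) & free [seq x - p | x <- q]].

(* The dimension of S, i.e. of its affine hull, is d. No d satisfies this
   for the empty set, whose dimension is -1. *)
Definition has_dim S d : Prop := affdim_ge S d /\ ~ affdim_ge S d.+1.

Definition is_face S F : Prop :=
  exists (a : {scalar E}) (b : R),
    (forall p, S p -> b <= a p) /\ F = [set p | S p /\ a p = b].

Definition is_facet S F : Prop :=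
  is_face S F /\ exists d, has_dim F d /\ has_dim S d.+1.

(* A function g : E -> R stands for the inequality 0 <= g. *)
Definition equality_set S (g : E -> R) : set E := [set p | S p /\ g p = 0].

Definition determines_facet S (g : E -> R) : Prop :=
  (forall p, S p -> 0 <= g p) /\ is_facet S (equality_set S g).

End Faces.

Section Trapezoid.
Variables (R : realType) (n m : nat).

(* An array of size (n, m) is given by a function of which only the entries
   X i j with i <= n and j <= i + m are ever used. *)
Implicit Types (X : nat -> nat -> R).

(* Meant for 1 <= j only. *)
Definition drow X (i j : nat) : R := X i j - X i j.-1.

Definition strip_concave X : Prop :=
  forall i, (1 <= i <= n)%N ->
    (forall j, (1 <= j <= i.-1 + m)%N -> drow X i.-1 j <= drow X i j) /\
    (forall j, (1 <= j <= (i + m).-1)%N -> drow X i j.+1 <= drow X i.-1 j).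

(* In all tuples, the k-th entry of the mathematical tuple (counted from 1)
   is the entry of index k - 1. *)
Definition lambda_of X : 'rV[R]_(n + m) := \row_j drow X n j.+1.
Definition blambda_of X : 'rV[R]_m := \row_j drow X 0 j.+1.
Definition mu_of X : 'rV[R]_n := \row_i (X i.+1 0%N - X i 0%N).
Definition nu_of X : 'rV[R]_n := \row_i (X i.+1 (i.+1 + m)%N - X i (i + m)%N).

Definition bspace : vectType R :=
  ('rV[R]_(n + m) * 'rV[R]_m * 'rV[R]_n * 'rV[R]_n)%type.

Definition boundary_cone : set bspace :=
  [set p | exists X, [/\ strip_concave X, X 0%N 0%N = 0 &
     p = (lambda_of X, blambda_of X, mu_of X, nu_of X)]].

Definition tsum k (d : 'rV[R]_k) (S : {set 'I_k}) : R := \sum_(i in S) d 0 i.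

(* J + k *)
Definition shift (J : {set 'I_m}) (k : nat) : {set 'I_(n + m)} :=
  [set i : 'I_(n + m) | [exists j in J, i == (j + k)%N :> nat]].

Definition star (I : {set 'I_n}) (J : {set 'I_m}) (p : bspace) : R :=
  let: (lam, blam, mu, nu) := p in
  tsum lam [set i : 'I_(n + m) | (i < #|I|)%N] + tsum lam (shift J #|I|)
  - tsum blam J + tsum mu I - tsum nu I.

Definition chamber (j j' : 'I_(n + m)) (p : bspace) : R :=
  let: (lam, _, _, _) := p in lam 0 j - lam 0 j'.

Definition bchamber (j j' : 'I_m) (p : bspace) : R :=
  let: (_, blam, _, _) := p in blam 0 j - blam 0 j'.

End Trapezoid.

(* Main.v *)
Require Import Defs.
From HB Require Import structures.
From mathcomp Require Import all_boot all_order all_algebra.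
From mathcomp Require Import classical_sets cardinality reals.
From mathcomp Require Import boolp ring lra zify.

(** Put w = nu - mu and b = blambda. Strip-concavity says that the difference
    rows of an array interlace, w_i is the increase of the row total from row
    i - 1 to row i, and mu is arbitrary. So the question is for which triples
    (lambda, b, w) there is an interlacing pattern with top row lambda, bottom row
    b and row total increments w, that is, a skew Gelfand-Tsetlin pattern of
    weight w.

    Inequalities. For |I| = k, the minimum over J of the terms of (star) that do
    not involve w is
      covered k = sum_(j < k) lambda_j + sum_i (min(b_i, lambda_(k+i)) - b_i),
    so the inequalities (star) say w(I) <= covered |I|. For partitions, covered k
    is the largest number of cells of the skew shape that k horizontal strips can
    cover: a column of height h contributes min(h, k). The inequalities are
    necessary by induction over the rows (pattern_covered). They suffice
    (pattern_exists), again by induction: it is enough to find the row x below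
    the top row y with
      total y - total x = t  and
      covered x k >= min(covered y k, covered y (k+1) - t),
    where t is the last entry of w. Cutting the bottom cell of each column of
    height more than p does this for t = covered y (p+1) - covered y p
    (covered_peel_low, covered_peel_high, row_total_peel). A general t lies
    between two such values for consecutive p, and the convex combination of the
    two rows works, because covered is concave in the row.

    Irredundant inequalities. If I is empty, (star) is a sum of inequalities
    lambda_j >= b_j, and if I is full it is, on the hyperplane, a sum of
    inequalities b_j >= lambda_(n+j). If n = 1, or n = 2 and m = 0, the chamber
    inequalities follow from the others. This leaves the list of facet_index
    (boundary_coneE).

    Facets. Let a cone be cut out of a hyperplane by finitely many inequalities,
    with a strictly feasible point, and for each inequality a point of the
    hyperplane that violates it and no other. Then the facets are the faces on
    which one inequality is tight, and these are pairwise distinct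
    (polycone_determines_facet, equality_set_inj, polycone_facet). So everything
    reduces to exhibiting points: interior_point, outer_witness and violator.
    Finally, the facets are counted by counting the inequalities. *)

Set Implicit Arguments.
Unset Strict Implicit.
Unset Printing Implicit Defensive.
Import Order.TTheory GRing.Theory Num.Theory.
Local Open Scope ring_scope.
Local Open Scope classical_set_scope.
Local Open Scope card_scope.

(** * Dimension and polyhedral cones *)

Section Dimension.
Variables (R : realType) (E : vectType R).
Implicit Types (S : set E) (U : {vspace E}).

Lemma affdim_ge_le S d e : (d <= e)%N -> affdim_ge S e -> affdim_ge S d.
Proof.
move=> le_de [p [q [Sp Sq fq]]].
have sz : size (take d q) == d by rewrite size_takel // size_tuple.
exists p, (Tuple sz); split=> //.
- move=> i; rewrite (tnth_nth p) /= nth_take //.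
  have lt_ie : (i < e)%N by apply: leq_trans le_de.
  by have := Sq (Ordinal lt_ie); rewrite (tnth_nth p).
- by move: fq; rewrite /= -{1}(cat_take_drop d q) map_cat => /catl_free.
Qed.

Lemma has_dim_uniq S d e : has_dim S d -> has_dim S e -> d = e.
Proof.
move=> [Sd Sd'] [Se Se']; apply/eqP; rewrite eqn_leq.
apply/andP; split; rewrite leqNgt; apply/negP => lt_.
- by apply: Se'; apply: affdim_ge_le Sd.
- by apply: Sd'; apply: affdim_ge_le Se.
Qed.

Lemma affdim_ge_sub S U d :
  (forall x, S x -> x \in U) -> affdim_ge S d -> (d <= \dim U)%N.
Proof.
move=> SU [p [q [Sp Sq fq]]].
have {fq} /eqP <- : \dim <<[seq x - p | x <- q]>> == d.
  by move: fq; rewrite /free size_map size_tuple.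
apply/dimvS/span_subvP => _ /mapP[x /tnthP[i ->] ->].
by apply: rpredB; apply: SU.
Qed.

(** A small ball of U around p provides the frame p + eps * (basis of U). *)
Lemma affdim_ge_ball S U p :
  S p -> (forall v, v \in U -> exists2 e : R, 0 < e & S (p + e *: v)) ->
  affdim_ge S (\dim U).
Proof.
move=> Sp ball.
have /choice[e eP] : forall i : 'I_(\dim U), exists e : R,
    0 < e /\ S (p + e *: (vbasis U)`_i).
  by move=> i; have [|e e0 Se] := ball (vbasis U)`_i;
    [rewrite vbasis_mem // mem_nth ?size_tuple | exists e].
exists p, [tuple p + e i *: (vbasis U)`_i | i < \dim U]; split=> //.
  by move=> i; rewrite tnth_mktuple; case: (eP i).
apply/(@freeP _ _ _ (map_tuple (fun x => x - p) [tuple p + e i *: (vbasis U)`_i | i < \dim U])).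
move=> k k0 i.
have /freeP/(_ (fun i => k i * e i)) kP := basis_free (vbasisP U).
have /eqP : k i * e i = 0.
  apply: kP; rewrite -[RHS]k0; apply: eq_bigr => j _.
  rewrite -[RHS]/(_ *: nth 0 _ _) (nth_map 0) ?size_tuple //= .
  rewrite (nth_map j) ?size_enum_ord // nth_ord_enum.
  by rewrite addrC addKr scalerA.
by rewrite mulf_eq0 (gt_eqF (proj1 (eP i))) orbF => /eqP.
Qed.

(** A linear form that is constant on S vanishes on all differences of points
    of S, which span U as soon as S has full dimension in U. *)
Lemma const_on_affdim S U (a : {scalar E}) (b : R) :
  (forall x, S x -> x \in U) -> affdim_ge S (\dim U) ->
  (forall x, S x -> a x = b) -> forall v, v \in U -> a v = 0.
Proof.
move=> SU [p [q [Sp Sq fq]]] ab v.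
have Uq : (<<[seq x - p | x <- q]>> <= U)%VS.
  apply/span_subvP => _ /mapP[x /tnthP[i ->] ->].
  by apply: rpredB; apply: SU.
have /eqP <- : <<[seq x - p | x <- q]>>%VS == U.
  by rewrite eqEdim Uq; move: fq; rewrite /free size_map size_tuple => /eqP ->; rewrite leqnn.
suff /subvP/(_ v) + : (<<[seq x - p | x <- q]>> <= lker (linfun (a : E -> R^o)))%VS.
  by move=> + vq => /(_ vq); rewrite memv_ker lfunE => /eqP.
apply/span_subvP => _ /mapP[x /tnthP[i ->] ->].
by rewrite memv_ker lfunE /= linearB /= !ab ?subrr.
Qed.

Lemma dim_cap_ker U (a : {scalar E}) p :
  p \in U -> a p != 0 ->
  (\dim (U :&: lker (linfun (a : E -> R^o)))).+1 = \dim U.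
Proof.
move=> Up ap; rewrite -(limg_ker_dim (linfun (a : E -> R^o)) U) -addn1.
congr addn; apply/eqP; rewrite eqn_leq; apply/andP; split.
  rewrite lt0n dimv_eq0 -subv0; apply/negP => /subvP/(_ (a p)).
  rewrite memv0 (negbTE ap) => F; suff : false by [].
  by apply: F; rewrite -[a p](lfunE (a : {linear E -> R^o})) memv_img.
by rewrite (leq_trans (dimvS (subvf _))) // dimvf.
Qed.
End Dimension.

Lemma small_step (R : realType) (T : finType) (a c : T -> R) :
  (forall t, 0 < a t) -> exists2 e, 0 < e & forall t, 0 < a t + e * c t.
Proof.
move=> a0; pose s := 1 + \sum_t `|c t| / a t.
have term_ge0 t : 0 <= `|c t| / a t by rewrite divr_ge0 // ltW.
have s_gt0 : 0 < s by rewrite ltr_wpDr // sumr_ge0.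
exists s^-1; first by rewrite invr_gt0.
move=> t.
have : `|c t| / a t < s.
  by rewrite /s (bigD1 t) //= addrCA ltrDl ltr_wpDr // sumr_ge0.
rewrite ltr_pdivrMr // => lt_cs.
rewrite -(pmulr_rgt0 _ s_gt0) mulrDr mulVKf ?gt_eqF //.
by have := ler_norm (- c t); rewrite normrN mulrC; lra.
Qed.

Section PolyhedralCone.
Variables (R : realType) (E : vectType R) (T : finType).
Variables (h : {scalar E}) (g : T -> {scalar E}).

Definition polycone : set E := [set p | h p = 0 /\ forall t, 0 <= g t p].

Hypothesis interior : exists p, h p = 0 /\ forall t, 0 < g t p.
Hypothesis irredundant : forall t, exists q,
  [/\ h q = 0, g t q < 0 & forall u, u != t -> 0 <= g u q].

Local Notation C := polycone.
Local Notation H0 := (lker (linfun (h : E -> R^o))).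
Local Notation F t := (equality_set C (g t)).

Let memH0 v : (v \in H0) = (h v == 0).
Proof. by rewrite memv_ker lfunE. Qed.

Lemma polycone_ball p v : h p = 0 -> (forall t, 0 < g t p) -> v \in H0 ->
  exists2 e : R, 0 < e & C (p + e *: v).
Proof.
move=> hp gp; rewrite memH0 => /eqP hv.
have [e e0 ge] := small_step (fun t => g t v) gp.
exists e => //; split; first by rewrite linearD linearZ /= hp hv mulr0 addr0.
by move=> t; rewrite linearD linearZ /= ltW.
Qed.

(** A point where all g t are positive is interior to the cone relative to the
    hyperplane h = 0. *)
Lemma polycone_dim : has_dim C (\dim H0).
Proof.
have [p [hp gp]] := interior; split; last first.
  move=> /(@affdim_ge_sub _ _ _ H0) lt_dim; suff : (\dim H0 < \dim H0)%N by rewrite ltnn.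
  by apply: lt_dim => x [hx _]; rewrite memH0 hx.
apply: (affdim_ge_ball (p := p)); first by split=> // t; rewrite ltW.
by move=> v; apply: polycone_ball.
Qed.

(** The segment from an interior point to a point that violates only the
    inequality t leaves the cone through the relative interior of the face t. *)
Lemma facet_point t :
  exists p, [/\ h p = 0, g t p = 0 & forall u, u != t -> 0 < g u p].
Proof.
have [p [hp gp]] := interior; have [q [hq gq guq]] := irredundant t.
exists (- g t q *: p + g t p *: q); split.
- by rewrite linearD !linearZ /= hp hq !mulr0 addr0.
- by rewrite linearD !linearZ /= mulNr mulrC addNr.
- move=> u ut; rewrite linearD !linearZ /= ltr_wpDr ?mulr_ge0 ?guq //.
    by rewrite ltW.
  by rewrite mulr_gt0 // oppr_gt0.
Qed.

Let facet_pointC t p : h p = 0 -> g t p = 0 -> (forall u, u != t -> 0 < g u p) ->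
  F t p.
Proof.
move=> hp gp gup; split=> //; split=> // u.
by have [->|/gup/ltW//] := eqVneq u t; rewrite gp.
Qed.

Let facet_span_dim t : (\dim (H0 :&: lker (linfun (g t : E -> R^o)))).+1 = \dim H0.
Proof.
have [p [hp gp]] := interior.
by apply: (dim_cap_ker (p := p)); rewrite ?memH0 ?hp // gt_eqF.
Qed.

Let memFt t x : F t x -> x \in (H0 :&: lker (linfun (g t : E -> R^o)))%VS.
Proof. by move=> [[hx _] gx]; rewrite memv_cap memH0 hx memv_ker lfunE /= gx !eqxx. Qed.

Lemma facet_dim t :
  has_dim (F t) (\dim (H0 :&: lker (linfun (g t : E -> R^o)))).
Proof.
split; last first.
  by move/(affdim_ge_sub (@memFt t)); rewrite ltnn.
have [p [hp gp gup]] := facet_point t.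
apply: (affdim_ge_ball (p := p)); first exact: facet_pointC.
move=> v; rewrite memv_cap memH0 memv_ker lfunE /= => /andP[/eqP hv /eqP gv].
have [|e e0 ge] := @small_step _ _ (fun u => if u == t then 1 else g u p) (fun u => g u v).
  by move=> u; case: eqVneq => // /gup.
have gt0 : g t (p + e *: v) = 0 by rewrite linearD linearZ /= gp gv mulr0 addr0.
exists e => //; apply: facet_pointC => // [|u ut].
  by rewrite linearD linearZ /= hp hv mulr0 addr0.
by have := ge u; rewrite (negbTE ut) linearD linearZ.
Qed.

Lemma polycone_determines_facet t : determines_facet C (g t).
Proof.
split; first by move=> p [].
split; last first.
  by eexists; split; [exact: facet_dim | rewrite facet_span_dim; exact: polycone_dim].
by exists (g t), 0; split=> // p [].
Qed.

(** The point of facet_point t lies on no other face, so already an inclusion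
    of faces identifies the inequalities. *)
Lemma equality_set_inj t u : F t `<=` F u -> t = u.
Proof.
have [p [hp gp gup]] := facet_point t => /(_ p).
case; first exact: facet_pointC.
by move=> _ gu0; apply/eqP; apply: contraT; rewrite eq_sym => /gup; rewrite gu0 ltxx.
Qed.

(** On a face of a cone the supporting linear form vanishes. If every g t were
    positive somewhere on the face, the sum of these points would be an interior
    point, and the face would be the whole cone; so a facet lies in some F t, and
    by dimension the form is proportional to g t on the hyperplane. *)
Lemma polycone_facet S : is_facet C S -> exists t, S = F t.
Proof.
move=> [[a [b [ab Sdef]]] [d [Sd Cd]]].
have dE : d.+1 = \dim H0 := has_dim_uniq Cd polycone_dim.
have C0 : C 0 by split=> [|t]; rewrite linear0.
have CD x y : C x -> C y -> C (x + y).
  move=> [hx gx] [hy gy]; split=> [|t]; first by rewrite linearD /= hx hy addr0.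
  by rewrite linearD addr_ge0.
(* 0 is in the cone, and so is twice a point of S; hence b <= 0 and b <= 2 b. *)
have b0 : b = 0.
  have [[s [_ [Ss _ _]]] _] := Sd; move: Ss; rewrite Sdef => -[Cs as_].
  apply/le_anti/andP; split; first by have := ab _ C0; rewrite linear0.
  by have := ab _ (CD _ _ Cs Cs); rewrite linearD as_ lerDl.
rewrite {}b0 in ab Sdef.
have [[t St]|noS] := pselect (exists t, forall x, S x -> g t x = 0).
  exists t.
  have SF x : S x -> F t x by move=> Sx; split; [move: Sx; rewrite Sdef => -[] | exact: St].
  have a0 : forall x, x \in (H0 :&: lker (linfun (g t : E -> R^o)))%VS -> a x = 0.
    apply: (@const_on_affdim _ _ S _ _ 0).
    - by move=> x /SF/memFt.
    - by have [] := Sd; have := facet_span_dim t; rewrite -dE => -[->].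
    - by move=> x; rewrite Sdef => -[].
  apply/seteqP; split=> // x Fx; rewrite Sdef; split; first by case: Fx.
  exact: a0 (memFt Fx).
have {noS} noS t : exists x, S x /\ g t x != 0.
  apply/not_existsP => noSt; apply: noS; exists t => x Sx.
  by apply/eqP; apply: contraPT (noSt x) => gx; apply; split.
have [x xP] := choice noS.
(* p lies on the face and is interior to the cone. *)
pose p := \sum_t x t.
have Cp : C p.
  by apply: (big_ind C) => // t _; case: (xP t); rewrite Sdef => -[].
have ap : a p = 0.
  by rewrite linear_sum big1 // => t _; case: (xP t); rewrite Sdef => -[].
have gp t : 0 < g t p.
  have Cx u : C (x u) by case: (xP u); rewrite Sdef => -[].
  have gtx u : 0 <= g t (x u) by case: (Cx u).
  rewrite linear_sum (bigD1 t) //= ltr_wpDr ?sumr_ge0 //.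
  by rewrite lt_def gtx andbT; case: (xP t).
have a0 v : v \in H0 -> 0 <= a v.
  case: Cp => hp _ /(polycone_ball hp gp)[e e0 /ab].
  by rewrite linearD linearZ /= ap add0r pmulr_rge0.
have SC : S = C.
  apply/seteqP; split=> y; rewrite Sdef; first by case.
  move=> Cy; split=> //; apply/le_anti; rewrite ab // andbT -oppr_ge0.
  rewrite -linearN; apply: a0.
  by case: Cy => hy _; rewrite memvN memH0 hy.
by rewrite SC in Sd; case: (n_Sn _ (has_dim_uniq Sd Cd)).
Qed.
End PolyhedralCone.

(** * Interlacing patterns with prescribed row totals *)

Section Interlacing.
Variables (R : realType) (m : nat) (b : nat -> R).
Implicit Types (x y : nat -> R) (n k : nat).

Definition interlace s x y := forall j, (j < s)%N -> y j.+1 <= x j <= y j.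

(** For partitions b and x, the number of cells of the skew shape x / b that k
    horizontal strips can cover. *)
Definition covered x k : R :=
  \sum_(0 <= j < k) x j + \sum_(0 <= i < m) (Num.min (b i) (x (k + i)%N) - b i).

Definition row_total s x : R := \sum_(0 <= j < s) x j.

(** The common source of both induction steps: y is the top row, x the row below
    it, and the two sums on the right are termwise nonnegative if the rows
    interlace, and termwise nonpositive if x = peel p y with p <= k. *)
Lemma covered_step n k x y : (k <= n)%N ->
  covered y k.+1 - covered x k - (row_total (n + m).+1 y - row_total (n + m) x) =
  \sum_(0 <= i < m) ((x (k + i)%N - y (k + i).+1)
     - (Num.min (b i) (x (k + i)%N) - Num.min (b i) (y (k + i).+1)))
  + \sum_(k + m <= j < n + m) (x j - y j.+1).
Proof.
move=> le_kn; rewrite /covered /row_total !big_nat_recl //.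
have split_sum (F : nat -> R) : \sum_(0 <= j < n + m) F j =
    \sum_(0 <= j < k) F j + \sum_(0 <= i < m) F (k + i)%N + \sum_(k + m <= j < n + m) F j.
  rewrite (@big_cat_nat _ _ _ k) /= ?leq0n //; last by rewrite (leq_trans le_kn) ?leq_addr.
  rewrite (@big_cat_nat _ _ _ (k + m) k) /= ?leq_addr ?leq_add2r // addrA.
  by congr (_ + _ + _); rewrite -{1}[k]add0n big_addn addKn; apply: eq_bigr => i _; rewrite addnC.
rewrite !split_sum !sumrB /=; under [X in _ + (X - _) - _]eq_bigr do rewrite addSn.
ring.
Qed.

Lemma interlace_min_gap (c x y : R) : y <= x ->
  Num.min c x - Num.min c y <= x - y.
Proof. by move=> ?; case: (leP c x); case: (leP c y) => *; lra. Qed.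

Lemma covered_le_step n k x y : (k <= n)%N -> interlace (n + m) x y ->
  covered x k + (row_total (n + m).+1 y - row_total (n + m) x) <= covered y k.+1.
Proof.
move=> le_kn xy; rewrite -subr_ge0.
have -> : covered y k.+1 - (covered x k + (row_total (n + m).+1 y - row_total (n + m) x))
  = covered y k.+1 - covered x k - (row_total (n + m).+1 y - row_total (n + m) x) by ring.
rewrite covered_step // addr_ge0 // big_nat_cond sumr_ge0 // => i /andP[/andP[_ lti] _].
- rewrite subr_ge0 interlace_min_gap //.
  have lt_ki : (k + i < n + m)%N by lia.
  by have /andP[] := xy _ lt_ki.
- by rewrite subr_ge0; have /andP[] := xy i lti.
Qed.

Lemma covered_mono n k x y : (k <= n)%N -> (forall j, (j < n + m)%N -> x j <= y j) ->
  covered x k <= covered y k.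
Proof.
move=> le_kn xy; rewrite /covered; apply: lerD; apply: ler_sum_nat => i /andP[_ lti].
  by apply: xy; rewrite (leq_trans lti) // (leq_trans le_kn) // leq_addr.
rewrite lerB // le_min !ge_min lexx /= xy ?orbT //.
have := ltn_add2l k i m; lia.
Qed.

(** For partitions, the row that remains after cutting from x the bottom cell of
    each column of height more than p in the skew shape x / b: such a column meets
    row j in the part beyond b (j - p). Entries of b before the first count as
    infinite and entries after the last as minus infinity. *)
Definition peel p x j : R :=
  if (j < p)%N then x j
  else if (j < p + m)%N then Num.min (x j) (Num.max (x j.+1) (b (j - p)))
  else x j.+1.

Hypothesis b_decr : forall i, (i.+1 < m)%N -> b i.+1 <= b i.

Let b_mono i j : (i <= j < m)%N -> b j <= b i.
Proof.
elim: j => [|j IH] /andP[]; first by rewrite leqn0 => /eqP ->.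
rewrite leq_eqVlt => /orP[/eqP -> //|lt_ij lt_jm].
by apply: (le_trans (b_decr lt_jm)); apply: IH; lia.
Qed.

Section Peel.
Variables (n : nat) (y : nat -> R).
Hypothesis y_decr : forall j, (j < n + m)%N -> y j.+1 <= y j.

Lemma peel_interlace p : interlace (n + m) (peel p y) y.
Proof.
move=> j /y_decr; rewrite /peel; case: ifP => _; first by move=> ->; rewrite lexx.
case: ifP => _; last by move=> ->; rewrite lexx.
by rewrite le_min !ge_min le_max !lexx => ->.
Qed.

(** Columns of height at most p stay, and the others keep at least p cells, so k
    strips with k <= p cover as much as before. *)
Lemma covered_peel_low p k : (k <= p <= n)%N -> covered y k <= covered (peel p y) k.
Proof.
move=> /andP[le_kp le_pn]; rewrite /covered; apply: lerD.
  by apply: ler_sum_nat => i /andP[_ lti]; rewrite /peel (leq_trans lti).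
apply: ler_sum_nat => i /andP[_ lti]; rewrite lerB // /peel.
case: ifP => // lt_p; case: ifP => lt_pm; last by lia.
have : b i <= b (k + i - p) by apply: b_mono; lia.
move=> b_le; rewrite le_min ge_min lexx /= le_min ge_min lexx orbT /= ge_min.
by rewrite le_max b_le orbT.
Qed.

(** For k >= p, a column of height h > k has lost its bottom cell, and
    min(h, k + 1) = min(h - 1, k) + 1; in a lower column, k strips cover all cells
    that were not cut. *)
Lemma covered_peel_high p k : (p <= k <= n)%N ->
  covered y k.+1 <= covered (peel p y) k + (row_total (n + m).+1 y - row_total (n + m) (peel p y)).
Proof.
move=> /andP[le_pk le_kn]; rewrite -subr_le0.
set x := peel p y.
have -> : covered y k.+1 - (covered x k + (row_total (n + m).+1 y - row_total (n + m) x))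
  = covered y k.+1 - covered x k - (row_total (n + m).+1 y - row_total (n + m) x) by ring.
rewrite covered_step // -[leRHS]addr0 lerD //.
  rewrite big_nat_cond sumr_le0 // => i /andP[/andP[_ lti] _].
  rewrite /x /peel ifN; last by rewrite -leqNgt; lia.
  have lt_ki : (k + i < n + m)%N by lia.
  have le_y := y_decr lt_ki; case: ifP => lt_pm; last by rewrite !subrr.
  have : b (k + i - p) <= b i by apply: b_mono; lia.
  move: (y (k + i)%N) (y (k + i).+1) (b (k + i - p)) (b i) le_y => u v d c le_vu le_dc.
  case: (leP v d) => ?; [case: (leP u d)|case: (leP u v)] => ?;
    case: (leP c v) => ?; try case: (leP c d) => ?; try case: (leP c u) => ?; lra.
rewrite big_nat_cond sumr_le0 // => j /andP[/andP[lej ltj] _].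
by rewrite /x /peel !ifN ?subrr //; rewrite -leqNgt; lia.
Qed.

(** Both bounds on the covered cells, and the general bound for interlacing
    rows, are tight at k = p. *)
Lemma row_total_peel p : (p <= n)%N ->
  row_total (n + m).+1 y - row_total (n + m) (peel p y) = covered y p.+1 - covered y p.
Proof.
move=> le_pn.
have I := peel_interlace p.
have := @covered_peel_high p p; have := @covered_peel_low p p.
have := covered_le_step le_pn I; have := @covered_mono n p (peel p y) y le_pn.
rewrite leqnn le_pn => /(_ _)/wrap[j lej|]; first by have /andP[] := I _ lej.
by move=> ? ? /(_ isT) ? /(_ isT) ?; lra.
Qed.
End Peel.

(** covered is a sum of minima of linear functions of the row. *)
Lemma covered_concave x y z k (s t : R) : 0 <= s -> 0 <= t -> s + t = 1 ->
  (forall j, z j = s * x j + t * y j) -> s * covered x k + t * covered y k <= covered z k.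
Proof.
move=> s0 t0 st zE; rewrite /covered !mulrDr addrACA; apply: lerD.
  rewrite !mulr_sumr -big_split /=; apply: ler_sum => j _.
  by rewrite zE.
rewrite !mulr_sumr -big_split /=; apply: ler_sum => i _.
set u := x _; set v := y _; rewrite zE -/u -/v.
have -> : s * (Num.min (b i) u - b i) + t * (Num.min (b i) v - b i)
  = s * Num.min (b i) u + t * Num.min (b i) v - b i.
  by (have -> : s = 1 - t by lra); ring.
rewrite lerB // le_min; apply/andP; split.
  by rewrite -[leRHS]mul1r -st mulrDl; apply: lerD; apply: ler_wpM2l => //; rewrite ge_min lexx.
by apply: lerD; apply: ler_wpM2l => //; rewrite ge_min lexx orbT.
Qed.

(** One step of the walk from D 0 to D n crosses the level t. The case p = q
    covers n = 0. *)
Lemma crossing (D : nat -> R) n t : D n <= t <= D 0%N ->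
  exists p q, [/\ (p <= q <= p.+1)%N, (q <= n)%N & D q <= t <= D p].
Proof.
elim: n => [|n IH] /andP[le_n ge_0]; first by exists 0%N, 0%N; rewrite le_n ge_0.
have [le_t|lt_t] := leP (D n) t.
  have [|p [q [pq qn Dt]]] := IH; first by rewrite le_t.
  by exists p, q; split=> //; apply: leqW.
by exists n, n.+1; split; rewrite ?leqnn ?leqnSn ?le_n ?(ltW lt_t).
Qed.

Lemma between_convex (u v t : R) : v <= t <= u ->
  exists s s' : R, [/\ 0 <= s, 0 <= s', s + s' = 1 & t = s * u + s' * v].
Proof.
move=> /andP[vt tu]; have [uv|uv] := eqVneq u v.
  by exists 1, 0; split; rewrite ?addr0 //; lra.
have le_vu := le_trans vt tu.
have d0 : 0 < u - v by rewrite subr_gt0 lt_def uv.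
exists ((t - v) / (u - v)), ((u - t) / (u - v)); split.
- by rewrite divr_ge0 ?subr_ge0.
- by rewrite divr_ge0 ?subr_ge0.
- by field; rewrite gt_eqF.
- by field; rewrite gt_eqF.
Qed.

Lemma convex_ge (s s' u v t : R) : 0 <= s -> 0 <= s' -> s + s' = 1 ->
  t <= u -> t <= v -> t <= s * u + s' * v.
Proof.
move=> s0 s'0 ss' tu tv; rewrite -[t]mul1r -ss' mulrDl.
by apply: lerD; apply: ler_wpM2l.
Qed.

Lemma convex_le (s s' u v t : R) : 0 <= s -> 0 <= s' -> s + s' = 1 ->
  u <= t -> v <= t -> s * u + s' * v <= t.
Proof.
move=> s0 s'0 ss' ut vt; rewrite -[t]mul1r -ss' mulrDl.
by apply: lerD; apply: ler_wpM2l.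
Qed.

Lemma covered0_le0 x : covered x 0 <= 0.
Proof.
rewrite /covered big_geq // add0r sumr_le0 // => i _.
by rewrite subr_le0 ge_min lexx.
Qed.

Lemma covered_full n x : covered x n <= row_total (n + m) x - row_total m b.
Proof.
rewrite /covered /row_total (@big_cat_nat _ _ _ n 0 (n + m)) ?leq0n ?leq_addr //=.
have -> : \sum_(n <= j < n + m) x j = \sum_(0 <= i < m) x (n + i)%N.
  by rewrite -{1}[n]add0n big_addn addKn; apply: eq_bigr => i _; rewrite addnC.
rewrite -addrA lerD2l -sumrB.
by apply: ler_sum => i _; rewrite lerB // ge_min lexx orbT.
Qed.

Lemma count_le n (I : nat -> bool) : (\sum_(0 <= i < n) I i <= n)%N.
Proof.
rewrite -[leqRHS]subn0 -[leqRHS]muln1 -sum_nat_const_nat.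
by apply: leq_sum => i _; case: (I i).
Qed.

(** If i is not in I, going up one row enlarges the entries; if i is in I, one more
    strip covers also the cells of the new row (covered_le_step). *)
Lemma pattern_covered n (r : nat -> nat -> R) (w : nat -> R) (I : nat -> bool) :
  (forall j, (j < m)%N -> r 0%N j = b j) ->
  (forall i, (i < n)%N -> interlace (i + m) (r i) (r i.+1) /\
     row_total (i.+1 + m) (r i.+1) - row_total (i + m) (r i) = w i) ->
  \sum_(0 <= i < n | I i) w i <= covered (r n) (\sum_(0 <= i < n) I i).
Proof.
move=> r0; elim: n => [|n IH] r_step.
  rewrite !big_geq // /covered big_geq // add0r big_nat_cond sumr_ge0 // => i.
  by rewrite andbT add0n => /andP[_ /r0 ->]; rewrite minxx subrr.
have {}IH := IH (fun i lt_in => r_step i (ltnW lt_in)).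
have [r_int wE] := r_step n (leqnn _).
have le_kn := count_le n I.
rewrite big_mkcond big_nat_recr //= -big_mkcond /= big_nat_recr //=.
case: (I n); last first.
  rewrite addr0 addn0; apply: (le_trans IH); apply: covered_mono le_kn _ => j lt_j.
  by have /andP[] := r_int j lt_j.
rewrite addn1 -wE; apply: le_trans (covered_le_step le_kn r_int).
by rewrite lerD2r.
Qed.

(** Only the values of I below n matter; plain predicates on nat spare the
    embedding of subsets of a row range into the next one. *)
Lemma pattern_exists n y (w : nat -> R) :
  (forall j, (j.+1 < n + m)%N -> y j.+1 <= y j) ->
  (forall I : nat -> bool,
    \sum_(0 <= i < n | I i) w i <= covered y (\sum_(0 <= i < n) I i)) ->
  \sum_(0 <= i < n) w i = row_total (n + m) y - row_total m b ->
  exists r : nat -> nat -> R,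
    [/\ forall j, (j < m)%N -> r 0%N j = b j, forall j, r n j = y j
      & forall i, (i < n)%N -> interlace (i + m) (r i) (r i.+1) /\
          row_total (i.+1 + m) (r i.+1) - row_total (i + m) (r i) = w i].
Proof.
elim: n y => [|n IH] y y_decr y_cov y_tot.
  exists (fun _ => y); split=> // j lt_jm.
  have := y_cov xpred0; rewrite !big_geq // /covered big_geq // add0r => cov_ge0.
  have gap_le0 i : Num.min (b i) (y (0 + i)%N) - b i <= 0 by rewrite subr_le0 ge_min lexx.
  have b_le i : (i < m)%N -> b i <= y i.
    move=> lt_im; apply: contraTT cov_ge0; rewrite -!ltNge => lt_yb.
    rewrite big_mkord (bigD1 (Ordinal lt_im)) //= ltr_wnDr ?sumr_le0 //.
    by rewrite subr_lt0 gt_min ltxx.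
  apply/eqP; rewrite -subr_eq0; apply/eqP.
  move: y_tot; rewrite big_geq // /row_total add0n -sumrB big_mkord => /esym/eqP.
  rewrite psumr_eq0 => [/allP/(_ (Ordinal lt_jm) (mem_index_enum _))/eqP //|i _].
  by rewrite subr_ge0 b_le.
have {}y_decr j : (j < n + m)%N -> y j.+1 <= y j by move=> lt_j; apply: y_decr.
have {}y_cov (I : nat -> bool) (c : bool) :
    \sum_(0 <= i < n | I i) w i + (if c then w n else 0)
      <= covered y (\sum_(0 <= i < n) I i + c).
  pose Ic i := if (i < n)%N then I i else c.
  have -> : \sum_(0 <= i < n | I i) w i + (if c then w n else 0)
      = \sum_(0 <= i < n.+1 | Ic i) w i.
    rewrite [RHS]big_mkcond big_nat_recr //= /Ic ltnn; congr (_ + _).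
    by rewrite [LHS]big_mkcond; apply: eq_big_nat => i /andP[_ ->].
  have -> : (\sum_(0 <= i < n) I i + c = \sum_(0 <= i < n.+1) Ic i)%N.
    rewrite [RHS]big_nat_recr //= /Ic ltnn; congr (_ + _)%N.
    by apply: eq_big_nat => i /andP[_ ->].
  exact: y_cov.
(* D p is the number of cells cut by peel p. *)
pose D k := covered y k.+1 - covered y k.
have D_bounds : D n <= w n <= D 0%N.
  have cnt_n : (\sum_(0 <= i < n) true = n)%N by rewrite sum_nat_const_nat subn0 muln1.
  have := y_cov xpred0 true; have := y_cov xpredT false; rewrite cnt_n /=.
  rewrite big_pred0_eq big1_eq addn0 add0n add0r addr0 => cov_n cov_1.
  have := covered_full n.+1 y; have := covered0_le0 y; move: y_tot.
  by rewrite big_nat_recr //= /D => ? ? ?; apply/andP; split; lra.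
have [p [q [/andP[le_pq le_qp] le_qn /between_convex[s [s' [s0 s'0 ss' wE]]]]]] :=
  crossing D_bounds.
have le_pn : (p <= n)%N by apply: leq_trans le_qn.
(* w n lies between D q and D p, so this mixture of two peels cuts exactly w n. *)
pose z j := s * peel p y j + s' * peel q y j.
have z_int : interlace (n + m) z y.
  move=> j lt_j; have /andP[? ?] := peel_interlace y_decr p lt_j.
  have /andP[? ?] := peel_interlace y_decr q lt_j.
  by rewrite /z convex_ge ?convex_le.
have z_tot : row_total (n.+1 + m) y - row_total (n + m) z = w n.
  have := row_total_peel y_decr le_pn; have := row_total_peel y_decr le_qn.
  rewrite -/(D p) -/(D q) wE addSn => <- <-.
  rewrite /row_total /z big_split -!mulr_sumr /=.
  have -> : s' = 1 - s by lra.
  ring.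
have [||| r [r0 rn r_step]] := IH z.
- move=> j lt_j; have /andP[_ le_zy] := z_int _ lt_j.
  have /andP[+ _] := z_int _ (ltnW lt_j); exact: le_trans.
- move=> I; set k := (\sum_(0 <= i < n) _)%N.
  have le_kn : (k <= n)%N by apply: count_le.
  have zE j : z j = s * peel p y j + s' * peel q y j by [].
  apply: le_trans (covered_concave k s0 s'0 ss' zE).
  have [le_kp|lt_pk] := leqP k p.
    have := y_cov I false; rewrite addr0 addn0 -/k => le_cov.
    have kp : (k <= p <= n)%N by rewrite le_kp.
    have kq : (k <= q <= n)%N by rewrite le_qn (leq_trans le_kp).
    have := covered_peel_low y kp; have := covered_peel_low y kq.
    by move=> ? ?; apply: (le_trans le_cov); apply: convex_ge.
  have := y_cov I true; rewrite addn1 -/k => le_cov.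
  have kp : (p <= k <= n)%N by rewrite le_kn ltnW.
  have kq : (q <= k <= n)%N by rewrite le_kn (leq_trans le_qp).
  have := covered_peel_high y_decr kp; have := covered_peel_high y_decr kq.
  rewrite !row_total_peel // -/(D p) -/(D q).
  move=> le_q le_p; have := convex_ge s0 s'0 ss' le_p le_q; lra.
- by move: y_tot; rewrite big_nat_recr //= -z_tot => ?; lra.
exists (fun i => if (i <= n)%N then r i else y); split=> [j /r0 //|j|i].
  by rewrite ltnn.
rewrite ltnS; case: (ltngtP i n) => // [lt_in|->] _; first exact: r_step.
split; first by move=> j lt_j; rewrite rn; apply: z_int.
by rewrite -z_tot /row_total; congr (_ - _); apply: eq_bigr => j _; rewrite rn.
Qed.
End Interlacing.

(** * The boundary cone by inequalities *)

Section Boundary.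
Variables (R : realType) (n m : nat).
Local Notation E := (bspace R n m).
Local Notation B := (@boundary_cone R n m).
Implicit Types (I : {set 'I_n}) (J : {set 'I_m}) (x b mu nu : nat -> R).

Lemma star_scalar I J : scalar (@star R n m I J).
Proof.
have tsumP k (S : {set 'I_k}) (a : R) (u v : 'rV[R]_k) :
    tsum (a *: u + v) S = a * tsum u S + tsum v S.
  by rewrite /tsum mulr_sumr -big_split; apply: eq_bigr => i _; rewrite !mxE.
by move=> a [[[? ?] ?] ?] [[[? ?] ?] ?]; rewrite /star /= !tsumP; ring.
Qed.
HB.instance Definition _ I J :=
  GRing.isLinear.Build R E R *%R (@star R n m I J) (star_scalar I J).

Lemma chamber_scalar j j' : scalar (@chamber R n m j j').
Proof. by move=> a [[[? ?] ?] ?] [[[? ?] ?] ?]; rewrite /chamber /= !mxE; ring. Qed.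
HB.instance Definition _ j j' :=
  GRing.isLinear.Build R E R *%R (@chamber R n m j j') (chamber_scalar j j').

Lemma bchamber_scalar j j' : scalar (@bchamber R n m j j').
Proof. by move=> a [[[? ?] ?] ?] [[[? ?] ?] ?]; rewrite /bchamber /= !mxE; ring. Qed.
HB.instance Definition _ j j' :=
  GRing.isLinear.Build R E R *%R (@bchamber R n m j j') (bchamber_scalar j j').

(** Points given by functions on nat, so that entries can be shifted without
    casts between ordinal types. *)
Definition mkpoint x b mu nu : E :=
  (\row_j x j, \row_j b j, \row_i mu i, \row_i nu i).

Lemma mkpoint_surj (p : E) : exists x b mu nu, p = mkpoint x b mu nu.
Proof.
have ext k (v : 'rV[R]_k) : exists x : nat -> R, v = \row_j x j.
  exists (fun j => if insub j is Some i then v 0 i else 0).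
  by apply/rowP => i; rewrite mxE valK.
case: p => [[[lam blam] mu] nu].
have [[x ->] [b ->]] := (ext _ lam, ext _ blam).
have [[u ->] [v ->]] := (ext _ mu, ext _ nu).
by exists x, b, u, v.
Qed.

Lemma tsum_row k x (S : {set 'I_k}) : tsum (\row_j x j) S = \sum_(j in S) x j.
Proof. by apply: eq_bigr => j _; rewrite mxE. Qed.

Lemma tsum_prefix N k x : (k <= N)%N ->
  tsum (\row_j x j) [set i : 'I_N | (i < k)%N] = \sum_(0 <= j < k) x j.
Proof.
move=> le_kN; rewrite tsum_row big_mkord (big_ord_widen N) //.
by apply: eq_bigl => i; rewrite inE.
Qed.

Lemma tsum_shift J k x : (k <= n)%N ->
  tsum (\row_j x j) (shift n J k) = \sum_(j in J) x (k + j)%N.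
Proof.
move=> le_kn; rewrite tsum_row.
have lt_shift (j : 'I_m) : (k + j < n + m)%N by have := ltn_ord j; lia.
have -> : shift n J k = [set Ordinal (lt_shift j) | j in J]%SET.
  apply/setP => i; rewrite inE; apply/exists_inP/imsetP => -[j Jj].
    by move/eqP => iE; exists j => //; apply: val_inj; rewrite /= iE addnC.
  by move=> ->; exists j; rewrite //= addnC.
by rewrite big_imset // => j j' _ _ /(congr1 val) /= /addnI /val_inj.
Qed.

Lemma starE I J x b mu nu :
  star I J (mkpoint x b mu nu) = \sum_(0 <= j < #|I|) x j
    + \sum_(j in J) (x (#|I| + j)%N - b j) - \sum_(i in I) (nu i - mu i).
Proof.
have le_In : (#|I| <= n)%N by rewrite -[leqRHS]card_ord max_card.
rewrite /star /mkpoint tsum_prefix ?(leq_trans le_In) ?leq_addr // tsum_shift //.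
by rewrite !tsum_row !sumrB; ring.
Qed.

Lemma star_fullE x b mu nu : star [set: 'I_n] [set: 'I_m] (mkpoint x b mu nu)
  = row_total (n + m) x - row_total m b - \sum_(0 <= i < n) (nu i - mu i).
Proof.
have sumT k (F : 'I_k -> R) : \sum_(i in [set: 'I_k]%SET) F i = \sum_i F i.
  by apply: eq_bigl => i; rewrite inE.
rewrite starE cardsT card_ord /row_total !big_mkord !sumT.
by rewrite big_split_ord /= sumrB; ring.
Qed.
Lemma covered_le_star J k x b :
  covered m b x k <= \sum_(0 <= j < k) x j + \sum_(j in J) (x (k + j)%N - b j).
Proof.
rewrite lerD2l big_mkord [leRHS]big_mkcond; apply: ler_sum => j _.
by case: ifP => _; [rewrite lerB // ge_min lexx orbT | rewrite subr_le0 ge_min lexx].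
Qed.

(** The minimising J consists of the indices where the minimum in covered is
    attained by the entry of x. *)
Lemma covered_star k x b : exists J,
  covered m b x k = \sum_(0 <= j < k) x j + \sum_(j in J) (x (k + j)%N - b j).
Proof.
exists [set j : 'I_m | x (k + j)%N < b j]%SET.
rewrite /covered; congr (_ + _); rewrite big_mkord [RHS]big_mkcond.
by apply: eq_bigr => j _; rewrite inE; case: ltP => _ //; rewrite subrr.
Qed.

Definition indic I (i : nat) : bool := if insub i is Some o then o \in I else false.

Lemma indicE I (i : 'I_n) : indic I i = (i \in I).
Proof. by rewrite /indic valK. Qed.

Lemma sum_indic I (w : nat -> R) :
  \sum_(0 <= i < n | indic I i) w i = \sum_(i in I) w i.
Proof. by rewrite big_mkord; apply: eq_bigl => i; rewrite indicE. Qed.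

Lemma count_indic I : (\sum_(0 <= i < n) indic I i = #|I|)%N.
Proof.
rewrite big_mkord -sum1_card [RHS]big_mkcond.
by apply: eq_bigr => i _; rewrite indicE; case: (i \in I).
Qed.

Lemma boundary_coneP x b mu nu : (0 < n)%N ->
  B (mkpoint x b mu nu) <->
  [/\ star [set: 'I_n] [set: 'I_m] (mkpoint x b mu nu) = 0,
      forall I J, 0 <= star I J (mkpoint x b mu nu),
      forall j, (j.+1 < n + m)%N -> x j.+1 <= x j
    & forall j, (j.+1 < m)%N -> b j.+1 <= b j].
Proof.
move=> n_gt0; pose w i := nu i - mu i; split.
  case=> X [X_sc _ [xE bE muE nuE]].
  pose r i j := drow X i j.+1.
  have {}xE j : (j < n + m)%N -> x j = r n j.
    by move=> lt_j; have /rowP/(_ (Ordinal lt_j)) := xE; rewrite !mxE.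
  have {}bE j : (j < m)%N -> b j = r 0%N j.
    by move=> lt_j; have /rowP/(_ (Ordinal lt_j)) := bE; rewrite !mxE.
  have {muE nuE}wE i : (i < n)%N ->
      w i = X i.+1 (i.+1 + m)%N - X i (i + m)%N - (X i.+1 0%N - X i 0%N).
    move=> lt_i; have /rowP/(_ (Ordinal lt_i)) := muE; rewrite !mxE /= /w => ->.
    by have /rowP/(_ (Ordinal lt_i)) := nuE; rewrite !mxE /= => ->.
  have r_tot i s : row_total s (r i) = X i s - X i 0%N.
    by rewrite /row_total -telescope_sumr.
  have r_step i : (i < n)%N -> interlace (i + m) (r i) (r i.+1) /\
     row_total (i.+1 + m) (r i.+1) - row_total (i + m) (r i) = w i.
    move=> lt_in; split; last by rewrite !r_tot wE //; ring.
    have [up down] := X_sc i.+1 lt_in.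
    by move=> j lt_j; rewrite /r (down j.+1) ?(up j.+1).
  have x_decr j : (j.+1 < n + m)%N -> x j.+1 <= x j.
    case: n n_gt0 xE r_step => // k _ xE r_step lt_j.
    have [/(_ j lt_j)/andP[le1 le2] _] := r_step k (leqnn _).
    by rewrite !xE ?(le_trans le1) // ltnW.
  split=> // [|I J|j lt_j].
  - have tot k : (k <= n)%N -> row_total (k + m) (r k) - row_total m (r 0%N)
        = \sum_(0 <= i < k) w i.
      elim: k => [_|k IH lt_kn]; first by rewrite big_geq // subrr.
      rewrite big_nat_recr //= -IH ?(ltnW lt_kn) //.
      by have [_ <-] := r_step k lt_kn; ring.
    rewrite star_fullE -tot // /row_total.
    have -> : \sum_(0 <= j < n + m) x j = \sum_(0 <= j < n + m) r n j.
      by apply: eq_big_nat => j /andP[_ /xE].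
    have -> : \sum_(0 <= j < m) b j = \sum_(0 <= j < m) r 0%N j.
      by apply: eq_big_nat => j /andP[_ /bE].
    by rewrite subrr.
  - rewrite starE subr_ge0; apply: le_trans (covered_le_star J #|I| x b).
    have le_In : (#|I| <= n)%N by rewrite -[leqRHS]card_ord max_card.
    apply: le_trans (covered_mono (x := r n) b le_In _); last by move=> j /xE ->.
    rewrite -(sum_indic I w) -count_indic.
    by apply: (pattern_covered _ _ r_step) => j /bE.
  - have [r_int _] := r_step 0%N n_gt0.
    have /andP[le1 _] := r_int j (ltnW lt_j); have /andP[_ le2] := r_int _ lt_j.
    by rewrite !bE ?(ltnW lt_j) // (le_trans le2).
case; rewrite star_fullE => /eqP; rewrite subr_eq0 => /eqP tot star_ge0 x_decr b_decr.
have [||r [r0 rn r_step]] := pattern_exists b_decr x_decr (w := w).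
- move=> I; pose I' := [set i : 'I_n | I i]%SET.
  have [J covE] := covered_star #|I'| x b.
  have := star_ge0 I' J; rewrite starE subr_ge0 -covE.
  have -> : \sum_(i in I') (nu i - mu i) = \sum_(0 <= i < n | I i) w i.
    by rewrite big_mkord; apply: eq_bigl => i; rewrite inE.
  suff -> : #|I'| = (\sum_(0 <= i < n) I i)%N by [].
  rewrite big_mkord -sum1_card big_mkcond; apply: eq_bigr => i _.
  by rewrite inE; case: (I i).
- by rewrite -tot.
(* The first column is free; it realises mu. *)
pose X i j := \sum_(0 <= k < i) mu k + \sum_(0 <= k < j) r i k.
have drowX i j : drow X i j.+1 = r i j.
  by rewrite /drow /X [\sum_(0 <= k < j.+1) _]big_nat_recr //=; ring.
have X0 i : X i.+1 0%N - X i 0%N = mu i.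
  rewrite /X big_nat_recr //= [X in _ + X - _]big_geq // [X in _ - (_ + X)]big_geq //.
  ring.
exists X; split.
- move=> [//|i] lt_in; have [r_int _] := r_step i lt_in.
  split=> -[//|j]; rewrite /= => lt_j; rewrite ?addSn /= !drowX.
    by have /andP[] := r_int j lt_j.
  by have /andP[] := r_int j lt_j.
- by rewrite /X !big_geq // addr0.
- congr (_, _, _, _); apply/rowP => i; rewrite !mxE ?drowX ?rn ?r0 ?X0 //.
  have [_ wE] := r_step i (ltn_ord i).
  have -> : nu i = mu i + w i by rewrite /w; ring.
  by rewrite -wE /X /row_total [\sum_(0 <= k < i.+1) _]big_nat_recr //=; ring.
Qed.
End Boundary.

(** * An irredundant list of inequalities *)

Section Essential.
Variables (R : realType) (n m : nat).
Hypothesis n_gt0 : (0 < n)%N.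
Local Notation E := (bspace R n m).
Local Notation B := (@boundary_cone R n m).
Local Notation hyper := (@star R n m [set: 'I_n] [set: 'I_m]).
Implicit Types (I : {set 'I_n}) (J : {set 'I_m}) (x b mu nu : nat -> R).

(** In this order: x_j >= b_j, b_j >= x_(n+j), and the two kinds of chamber
    inequalities. The first two are the inequalities (star) with I empty and J a
    singleton, and with I full and J the complement of a singleton. *)
Definition outer_index : finType :=
  ('I_m + 'I_m + ('I_(n + m) * 'I_(n + m) + 'I_m * 'I_m))%type.
Definition ineq_index : finType := ({set 'I_n} * {set 'I_m} + outer_index)%type.

Definition outer_essential (o : outer_index) : bool :=
  match o with
  | inl _ => true
  | inr (inl (j, j')) => [&& 1 < n, 2 < n + m & j' == j.+1 :> nat]%N
  | inr (inr (j, j')) => (1 < n)%N && (j' == j.+1 :> nat)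
  end.

Definition essential (t : ineq_index) : bool :=
  match t with
  | inl IJ => (0 < #|IJ.1| < n)%N
  | inr o => outer_essential o
  end.

Definition ineq_form (t : ineq_index) : {scalar E} :=
  match t with
  | inl IJ => @star R n m IJ.1 IJ.2
  | inr (inl (inl j)) => @star R n m finset.set0 [set j]%SET
  | inr (inl (inr j)) => @star R n m [set: 'I_n] (~: [set j])%SET
  | inr (inr (inl jj)) => @chamber R n m jj.1 jj.2
  | inr (inr (inr jj)) => @bchamber R n m jj.1 jj.2
  end.

(** The value of an outer inequality on the hyperplane; it depends only on the
    top row x and the bottom row b. *)
Definition slack (o : outer_index) x b : R :=
  match o with
  | inl (inl j) => x j - b j
  | inl (inr j) => b j - x (n + j)%N
  | inr (inl jj) => x jj.1 - x jj.2
  | inr (inr jj) => b jj.1 - b jj.2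
  end.

Lemma star_set0E J x b mu nu :
  star (finset.set0 : {set 'I_n}) J (mkpoint n m x b mu nu) = \sum_(j in J) (x j - b j).
Proof. by rewrite starE cards0 big_geq // big_set0 add0r subr0. Qed.

(** The form of (star) seen from the complements of I and J, as obtained by
    subtracting it from the equation of the hyperplane. *)
Lemma star_dualE I J x b mu nu :
  star I J (mkpoint n m x b mu nu) = hyper (mkpoint n m x b mu nu)
   + \sum_(j in (~: J)%SET) (b j - x (#|I| + j)%N)
   - \sum_(#|I| + m <= j < n + m) x j + \sum_(i in (~: I)%SET) (nu i - mu i).
Proof.
have le_In : (#|I| <= n)%N by rewrite -[leqRHS]card_ord max_card.
have sumC k (S : {set 'I_k}) (F : nat -> R) :
    \sum_(i in S) F i = \sum_(0 <= i < k) F i - \sum_(i in (~: S)%SET) F i.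
  have -> : \sum_(i in (~: S)%SET) F i = \sum_(i < k | i \notin S) F i.
    by apply: eq_bigl => i; rewrite inE.
  by rewrite big_mkord [X in _ = X - _](bigID (mem S)) /= addrK.
rewrite starE star_fullE (sumC _ J (fun j => x (#|I| + j)%N - b j)).
rewrite (sumC _ I (fun i => nu i - mu i)) /row_total.
rewrite (@big_cat_nat _ _ _ #|I| 0 (n + m)) /= ?(leq_trans le_In) ?leq_addr //.
rewrite (@big_cat_nat _ _ _ (#|I| + m) #|I| (n + m)) /= ?leq_addr ?leq_add2r //.
have -> : \sum_(#|I| <= j < #|I| + m) x j = \sum_(0 <= j < m) x (#|I| + j)%N.
  by rewrite -{1}[#|I|]add0n big_addn addKn; apply: eq_bigr => i _; rewrite addnC.
rewrite !sumrB; ring.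
Qed.

Lemma star_setTE J x b mu nu :
  star [set: 'I_n] J (mkpoint n m x b mu nu) = hyper (mkpoint n m x b mu nu)
   + \sum_(j in (~: J)%SET) (b j - x (n + j)%N).
Proof.
by rewrite star_dualE cardsT card_ord big_geq // finset.setCT big_set0 subr0 addr0.
Qed.

Lemma ineq_form_outerE o x b mu nu : hyper (mkpoint n m x b mu nu) = 0 ->
  ineq_form (inr o) (mkpoint n m x b mu nu) = slack o x b.
Proof.
move=> h0; case: o => [[j|j]|[[j j']|[j j']]].
- by rewrite [LHS]star_set0E big_set1.
- by rewrite [LHS]star_setTE h0 add0r finset.setCK big_set1.
- by rewrite /= /chamber /mkpoint !mxE.
- by rewrite /= /bchamber /mkpoint !mxE.
Qed.
Definition facet_index := {t : ineq_index | essential t}.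

Definition facet_form (t : facet_index) : {scalar E} := ineq_form (val t).

(** For n = 1 the inequalities x_j >= b_j >= x_(j+1) >= b_(j+1) give all chamber
    inequalities; for n = 2 and m = 0, adding w_0 <= x_0 and w_1 <= x_0 gives
    x_0 + x_1 <= 2 x_0. *)
Lemma essential_chambers x b mu nu :
  hyper (mkpoint n m x b mu nu) = 0 ->
  (forall t, essential t -> 0 <= ineq_form t (mkpoint n m x b mu nu)) ->
  (forall j, (j.+1 < n + m)%N -> x j.+1 <= x j) /\
  (forall j, (j.+1 < m)%N -> b j.+1 <= b j).
Proof.
move=> h0 ge0.
have outer o : outer_essential o -> 0 <= slack o x b.
  by move=> oE; rewrite -(ineq_form_outerE o h0); apply: ge0.
have low j : (j < m)%N -> b j <= x j.
  by move=> lt_j; have := outer (inl (inl (Ordinal lt_j))) isT; rewrite subr_ge0.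
have high j : (j < m)%N -> x (n + j)%N <= b j.
  by move=> lt_j; have := outer (inl (inr (Ordinal lt_j))) isT; rewrite subr_ge0.
have [n1|n2|] := ltngtP n 1; [by lia | | move=> n1]; last first.
  split=> j lt_j.
    have lt_jm : (j < m)%N by lia.
    by rewrite (le_trans _ (low j lt_jm)) //; have := high j lt_jm; rewrite n1.
  rewrite (le_trans (low j.+1 lt_j)) //.
  by have := high j (ltnW lt_j); rewrite n1.
split=> j lt_j; last first.
  have := outer (inr (inr (Ordinal (ltnW lt_j), Ordinal lt_j))).
  by rewrite /= n2 eqxx subr_ge0; apply.
have [nm3|nm2] := ltnP 2 (n + m).
  have := outer (inr (inl (Ordinal (ltnW lt_j), Ordinal lt_j))).
  by rewrite /= n2 nm3 eqxx subr_ge0; apply.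
have nE : n = 2%N by lia.
have mE : m = 0%N by lia.
have j0 : j = 0%N by lia.
have wle i : (i < n)%N -> nu i - mu i <= x 0%N.
  move=> lt_i; pose I := [set Ordinal lt_i]%SET.
  have IE : essential (inl (I, finset.set0)) by rewrite /= cards1.
  have : 0 <= star I finset.set0 (mkpoint n m x b mu nu) := ge0 _ IE.
  by rewrite starE cards1 big_nat1 big_set0 addr0 big_set1 subr_ge0.
have := wle 0%N n_gt0; have := wle 1%N n2.
move: h0; rewrite star_fullE /row_total mE addn0 nE j0.
by rewrite [\sum_(0 <= j < 0) _]big_geq // !big_nat_recr //= !big_geq // => *; lra.
Qed.

Lemma boundary_coneE : B = polycone hyper facet_form.
Proof.
apply/seteqP; split=> p; have [x [b [mu [nu ->]]]] := mkpoint_surj p.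
  move=> /(boundary_coneP _ _ _ _ _ n_gt0) [h0 star_ge0 x_decr b_decr].
  split=> // -[[[I J]|o] /= oE]; rewrite /facet_form /=; first exact: star_ge0.
  rewrite -/(ineq_form (inr o)) ineq_form_outerE //.
  case: o oE => [[j|j]|[[j j']|[j j']]] /=.
  - by move=> _; have := star_ge0 finset.set0 [set j]%SET; rewrite star_set0E big_set1.
  - move=> _; have := star_ge0 [set: 'I_n]%SET (~: [set j])%SET.
    by rewrite star_setTE h0 add0r finset.setCK big_set1.
  - by move=> /and3P[_ _ /eqP jE]; rewrite subr_ge0 jE x_decr // -jE ltn_ord.
  - by move=> /andP[_ /eqP jE]; rewrite subr_ge0 jE b_decr // -jE ltn_ord.
move=> [h0 ge0]; apply/(boundary_coneP _ _ _ _ _ n_gt0).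
have {}ge0 t : essential t -> 0 <= ineq_form t (mkpoint n m x b mu nu).
  by move=> tE; have := ge0 (exist _ t tE).
have [x_decr b_decr] := essential_chambers h0 ge0.
split=> // I J.
have [I0|I_gt0] := posnP #|I|.
  rewrite (cards0_eq I0) star_set0E sumr_ge0 // => j _.
  by have := ge0 (inr (inl (inl j))) isT; rewrite ineq_form_outerE.
have := max_card (mem I); rewrite card_ord leq_eqVlt => /orP[/eqP In|In].
  have -> : I = [set: 'I_n]%SET.
    by apply/eqP; rewrite eqEcard finset.subsetT cardsT card_ord In leqnn.
  rewrite star_setTE h0 add0r sumr_ge0 // => j _.
  by have := ge0 (inr (inl (inr j))) isT; rewrite ineq_form_outerE.
by apply: (ge0 (inl (I, J))); rewrite /= I_gt0.
Qed.
End Essential.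

(** * Violating a single inequality: I empty or full, and chambers *)

Section Witnesses.
Variables (R : realType) (n m : nat).
Hypothesis n_gt0 : (0 < n)%N.
Local Arguments star : simpl never.
Local Notation E := (bspace R n m).
Local Notation hyper := (@star R n m [set: 'I_n] [set: 'I_m]).
Local Notation T := (ineq_index n m).
Local Notation ineq_form := (@ineq_form R n m).
Implicit Types (I : {set 'I_n}) (J : {set 'I_m}) (x b w : nat -> R).

Local Notation point x b w := (mkpoint n m x b (fun=> 0) w).

(** Two rays of the cone on which all inequalities (star) with 0 < |I| < n are
    strict: their values there are n - |I| and |I|. *)
Definition top_dir : E := point (fun j => if j == 0%N then n%:R else 0) (fun=> 0) (fun=> 1).
Definition bottom_dir : E :=
  point (fun j => if j == (n + m).-1 then - n%:R else 0) (fun=> 0) (fun=> - 1).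

Lemma top_dir_hyper : hyper top_dir = 0.
Proof.
rewrite star_fullE /row_total; case: n n_gt0 => // k _.
rewrite addSn big_nat_recl //= !big1_eq addr0 subr0.
by rewrite sumr_const_nat !subn0 subr0 subrr.
Qed.

Lemma bottom_dir_hyper : hyper bottom_dir = 0.
Proof.
rewrite star_fullE /row_total; case: n n_gt0 => // k _.
rewrite addSn big_nat_recr //= eqxx big_nat_cond big1 => [|j /andP[/andP[_ lt_j] _]]; last first.
  by rewrite ltn_eqF.
by rewrite !big1_eq sumr_const_nat subn0 !subr0 mulNrn opprK sub0r addNr.
Qed.

Lemma top_dir_inner I J : (0 < #|I| < n)%N -> 0 < star I J top_dir.
Proof.
move=> /andP[I_gt0 lt_In]; rewrite starE.
rewrite [X in _ + X - _]big1 ?addr0 => [|j _]; last by case: #|I| I_gt0 => // k _ /=; rewrite subr0.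
rewrite /= subr0 sumr_const -(prednK I_gt0) big_nat_recl //= big1_eq addr0.
by rewrite subr_gt0 ltr_nat prednK.
Qed.

Lemma bottom_dir_inner I J : (0 < #|I| < n)%N -> 0 < star I J bottom_dir.
Proof.
move=> /andP[I_gt0 lt_In]; rewrite starE; set k := #|I| in I_gt0 lt_In *.
rewrite big_nat_cond big1 ?add0r => [|j /andP[/andP[_ lt_j] _]]; last first.
  by rewrite ltn_eqF //; lia.
rewrite big1 ?add0r => [|j _]; last first.
  by have lt_j := ltn_ord j; rewrite /= subr0 ltn_eqF //; lia.
by rewrite /= subr0 sumr_const mulNrn opprK ltr0n.
Qed.

Lemma dir_slack_ge0 (o : outer_index n m) : outer_essential o ->
  0 <= slack o (fun j => if j == 0%N then n%:R else 0 : R) (fun=> 0) /\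
  0 <= slack o (fun j => if j == (n + m).-1 then - n%:R else 0 : R) (fun=> 0).
Proof.
have n_ge0 : 0 <= n%:R :> R by apply: ler0n.
case: o => [[j|j]|[[j j']|[j j']]] /=; rewrite ?subrr //.
- by have lt_j := ltn_ord j; split; rewrite subr0; [case: ifP | rewrite ltn_eqF //; lia].
- by split; rewrite sub0r oppr_ge0; case: ifP => //; rewrite ?oppr_le0 //; lia.
- move=> /and3P[_ _ /eqP jE]; have := ltn_ord j'; rewrite jE => lt_j; split.
    by rewrite subr0; case: ifP.
  rewrite [j == _ :> nat]ltn_eqF; last by lia.
  by rewrite sub0r oppr_ge0; case: ifP => //; rewrite oppr_le0.
Qed.

Lemma perturb (e q : E) : hyper e = 0 -> hyper q = 0 ->
  (forall I J, (0 < #|I| < n)%N -> 0 < star I J e) ->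
  exists2 d : R, 0 < d & hyper (e + d *: q) = 0 /\
    forall I J, (0 < #|I| < n)%N -> 0 < star I J (e + d *: q).
Proof.
move=> he hq inner_e.
have [|d d0 inner_d] := @small_step _ ({set 'I_n} * {set 'I_m})%type
  (fun t => if (0 < #|t.1| < n)%N then star t.1 t.2 e else 1)
  (fun t => star t.1 t.2 q).
  by move=> [I J] /=; case: ifP => // /inner_e.
exists d => //; split; first by rewrite linearD linearZ /= he hq mulr0 addr0.
move=> I J IE; have := inner_d (I, J); rewrite /= IE => lt0.
by rewrite linearD linearZ.
Qed.

Lemma lift_outer x b : exists q : E, hyper q = 0 /\
  forall o, ineq_form (inr o) q = slack o x b.
Proof.
pose t := row_total (n + m) x - row_total m b.
pose q : E := point x b (fun i => if i == 0%N then t else 0).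
have hq : hyper q = 0.
  rewrite star_fullE -/t; case: n n_gt0 => // k _.
  by rewrite big_nat_recl //= subr0 big1 ?addr0 ?subrr // => i _; rewrite subrr.
by exists q; split=> // o; rewrite ineq_form_outerE.
Qed.

Lemma interior_point : exists p : E, hyper p = 0 /\
  forall t : facet_index n m, 0 < facet_form R t p.
Proof.
have [q [hq qE]] := lift_outer (fun j => - (j.*2)%:R) (fun j => - (j.*2.+1)%:R).
have [d d0 [hd inner_d]] := perturb top_dir_hyper hq top_dir_inner.
exists (top_dir + d *: q); split=> // -[[[I J]|o] /= oE]; first exact: inner_d.
rewrite /facet_form /= -/(ineq_form (inr o)) linearD linearZ /= qE.
rewrite ineq_form_outerE ?top_dir_hyper //.
have [ge0 _] := dir_slack_ge0 oE; rewrite ltr_wpDl // mulr_gt0 // {ge0}.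
case: o oE => [[j|j]|[[j j']|[j j']]] /=; rewrite ?opprK.
- by move=> _; rewrite addrC subr_gt0 ltr_nat.
- by move=> _; rewrite addrC subr_gt0 ltr_nat; lia.
- by move=> /and3P[_ _ /eqP ->]; rewrite addrC subr_gt0 ltr_nat; lia.
- by move=> /andP[_ /eqP ->]; rewrite addrC subr_gt0 ltr_nat; lia.
Qed.
Lemma subb_ge0 (a c : bool) : (c ==> a) -> 0 <= a%:R - c%:R :> R.
Proof. by rewrite subr_ge0 ler_nat; case: a c => -[]. Qed.

(** The violating rows have entries 0 and 1, chosen such that the two entries
    compared by o are the only ones in the wrong order. *)
Lemma outer_violation (o : outer_index n m) : outer_essential o -> exists x b,
  slack o x b < 0 /\
  forall o', outer_essential o' -> o' != o -> 0 <= slack o' x b.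
Proof.
case: o => [[k|k]|[[k k']|[k k']]] oE.
- exists (fun j => (j < k)%N%:R), (fun j => (j <= k)%N%:R).
  split; first by rewrite /= ltnn leqnn sub0r oppr_lt0.
  move=> [[j|j]|[[j j']|[j j']]] /= o'E ne; apply: subb_ge0; apply/implyP.
  + have : j != k :> nat by apply: contraNneq ne => /val_inj ->.
    by lia.
  + by lia.
  + by case/and3P: o'E => _ _ /eqP ->; lia.
  + by case/andP: o'E => _ /eqP ->; lia.
- exists (fun j => (j <= n + k)%N%:R), (fun j => (j < k)%N%:R).
  split; first by rewrite /= ltnn leqnn sub0r oppr_lt0.
  move=> [[j|j]|[[j j']|[j j']]] /= o'E ne; apply: subb_ge0; apply/implyP.
  + by lia.
  + have : j != k :> nat by apply: contraNneq ne => /val_inj ->.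
    by lia.
  + by case/and3P: o'E => _ _ /eqP ->; lia.
  + by case/andP: o'E => _ /eqP ->; lia.
- case/and3P: oE => n2 _ /eqP k'E.
  exists (fun j => ((j < k) || (j == k.+1))%N%:R), (fun j => (j < k)%N%:R).
  split; first by rewrite /= k'E ltnn eqxx orbT ltn_eqF // sub0r oppr_lt0.
  move=> [[j|j]|[[j j']|[j j']]] /= o'E ne; apply: subb_ge0; apply/implyP.
  + by lia.
  + by lia.
  + case/and3P: o'E => _ _ /eqP j'E.
    have : j != k :> nat.
      apply: contraNneq ne => jk; apply/eqP; congr (inr (inl (_, _))); apply: val_inj => //=.
      by rewrite j'E k'E jk.
    by rewrite j'E; lia.
  + by case/andP: o'E => _ /eqP ->; lia.
- case/andP: oE => n2 /eqP k'E.
  exists (fun j => (j <= k.+1)%N%:R), (fun j => ((j < k) || (j == k.+1))%N%:R).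
  split; first by rewrite /= k'E ltnn eqxx orbT ltn_eqF // sub0r oppr_lt0.
  move=> [[j|j]|[[j j']|[j j']]] /= o'E ne; apply: subb_ge0; apply/implyP.
  + by lia.
  + by lia.
  + by case/and3P: o'E => _ _ /eqP ->; lia.
  + case/andP: o'E => _ /eqP j'E.
    have : j != k :> nat.
      apply: contraNneq ne => jk; apply/eqP; congr (inr (inr (_, _))); apply: val_inj => //=.
      by rewrite j'E k'E jk.
    by rewrite j'E; lia.
Qed.

(** A direction of the cone that leads away from all inequalities with
    0 < |I| < n without repairing a violation of o. *)
Definition inner_dir (o : outer_index n m) (e : E) : Prop :=
  [/\ hyper e = 0, forall I J, (0 < #|I| < n)%N -> 0 < star I J e,
     ineq_form (inr o) e = 0
   & forall o', outer_essential o' -> 0 <= ineq_form (inr o') e].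

(** top_dir is tight for o unless o involves the first entry of the top row, and
    bottom_dir unless it involves the last one; no o but the chamber inequality of
    a top row of length two involves both, and that one is not essential. *)
Lemma inner_dir_exists (o : outer_index n m) : outer_essential o ->
  exists e : E, inner_dir o e.
Proof.
move=> oE.
have topP : ineq_form (inr o) top_dir = 0 -> exists e, inner_dir o e.
  move=> top0; exists top_dir; split=> //.
  - exact: top_dir_hyper.
  - exact: top_dir_inner.
  move=> o' /dir_slack_ge0[ge0 _]; rewrite ineq_form_outerE //.
  exact: top_dir_hyper.
have bottomP : ineq_form (inr o) bottom_dir = 0 -> exists e, inner_dir o e.
  move=> bot0; exists bottom_dir; split=> //.
  - exact: bottom_dir_hyper.
  - exact: bottom_dir_inner.
  move=> o' /dir_slack_ge0[_ ge0]; rewrite ineq_form_outerE //.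
  exact: bottom_dir_hyper.
have := ineq_form_outerE o top_dir_hyper; have := ineq_form_outerE o bottom_dir_hyper.
case: o oE topP bottomP => [[k|k]|[[k k']|[k k']]] oE topP bottomP botE topE.
- apply: bottomP; rewrite botE /= ltn_eqF ?subr0 //.
  by have := ltn_ord k; lia.
- apply: topP; rewrite topE /= gtn_eqF ?subr0 //; lia.
- case/and3P: oE => n2 nm3 /eqP k'E.
  have [k0|k_gt0] := posnP k.
    by apply: bottomP; rewrite botE /= k'E k0 !ltn_eqF ?subr0 //; lia.
  by apply: topP; rewrite topE /= k'E gtn_eqF // subr0.
- by apply: topP; rewrite topE /= subr0.
Qed.

Lemma outer_witness (o : outer_index n m) : outer_essential o -> exists q : E,
  [/\ hyper q = 0, ineq_form (inr o) q < 0
    & forall t, essential t -> t != inr o -> 0 <= ineq_form t q].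
Proof.
move=> oE; have [x [b [oneg opos]]] := outer_violation oE.
have [e [he inner_e o0 outer_e]] := inner_dir_exists oE.
have [q [hq qE]] := lift_outer x b.
have [d d0 [hd inner_d]] := perturb he hq inner_e.
exists (e + d *: q); split=> //.
  by rewrite linearD linearZ /= -/(ineq_form (inr o)) qE -/(ineq_form (inr o)) o0 add0r pmulr_rlt0.
move=> [[I J]|o'] /= tE ne; first exact/ltW/inner_d.
rewrite -/(ineq_form (inr o')) linearD linearZ /= -/(ineq_form (inr o')) qE.
by rewrite addr_ge0 ?outer_e // mulr_ge0 ?opos // ltW.
Qed.
End Witnesses.

(** * Violating a single inequality: I proper and nonempty *)

Lemma card_setC k (S : {set 'I_k}) : #|(~: S)%SET| = (k - #|S|)%N.
Proof. by rewrite cardsCs finset.setCK card_ord. Qed.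

Section InnerWitness.
Variables (R : realType) (n m : nat) (I : {set 'I_n}) (J : {set 'I_m}).
Local Arguments star : simpl never.
Hypothesis I_inner : (0 < #|I| < n)%N.
Local Notation E := (bspace R n m).
Local Notation hyper := (@star R n m [set: 'I_n] [set: 'I_m]).
Local Notation k := #|I|.

Let k_gt0 : (0 < k)%N. Proof. by case/andP: I_inner. Qed.
Let k_ltn : (k < n)%N. Proof. by case/andP: I_inner. Qed.
Let le_Jm : (#|J| <= m)%N. Proof. by rewrite -[leqRHS]card_ord max_card. Qed.

(** The negatives of stair, bstair and weight are the rows and the weight of a
    point that violates only (star) for I and J. With k = |I|, the middle part
    x_(k+j) = - 2 (j + 1) of the top row is a staircase, and b_j lies one above it
    if j is in J and one below otherwise; this makes J the only minimiser for
    sets of size k. The rest of the top row consists of the plateaus 0 and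
    - (2 m + 2), except that the entries -1 and - (2 m + 1) next to the staircase
    lower covered at k alone. For |I'| < k the inequalities then only require that
    sums of w are at most 0, and for |I'| > k that they are at least
    - (2 m + 2) times the number of terms, by star_dualE. *)
Definition stair (j : nat) : nat :=
  if (j.+1 < k)%N then 0
  else if (j < k)%N then 1
  else if (j < k + m)%N then ((j - k).+1).*2
  else if (j == k + m)%N then m.*2.+1 else m.*2.+2.

Definition bstair (j : nat) : nat := if indic J j then j.*2.+1 else j.*2.+3.

Variables (i0 i1 : 'I_n).
Hypotheses (Ii0 : i0 \in I) (Ii1 : i1 \notin I).

(** At the plateau values, except that i0 and i1 correct the totals over I and
    over its complement such that w(I) = - |J| exceeds covered k = - |J| - 1 by one
    and the point lies on the hyperplane. *)
Definition weight (i : nat) : nat :=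
  if indic I i then (if i == i0 then #|J| else 0)
  else (if i == i1 then m.+2 + #|J| else m.*2.+2)%N.

Definition violator : E :=
  mkpoint n m (fun j => - (stair j)%:R) (fun j => - (bstair j)%:R)
    (fun=> 0) (fun i => - (weight i)%:R).

Lemma stair_mono j : (stair j <= stair j.+1)%N.
Proof. by rewrite /stair; repeat case: ifP; lia. Qed.

Lemma stair_low k' j : (k' < k)%N -> (j < m)%N -> (stair (k' + j) <= bstair j)%N.
Proof. by rewrite /stair /bstair => ? ?; repeat case: ifP; lia. Qed.

Lemma stair_high k' j : (k < k')%N -> (j < m)%N -> (bstair j <= stair (k' + j))%N.
Proof. by rewrite /stair /bstair => ? ?; repeat case: ifP; lia. Qed.

Lemma stair_mid j : (j < m)%N ->
  (bstair j)%:R - (stair (k + j))%:R = (if indic J j then - 1 else 1) :> R.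
Proof.
move=> lt_j; have -> : stair (k + j) = (j.*2.+2)%N.
  by rewrite /stair; repeat case: ifP; lia.
rewrite /bstair; case: ifP => _; last by rewrite -natrB // subSnn.
by rewrite -[_.+2]addn1 natrD; ring.
Qed.

Let starE' I' J' : star I' J' violator = - \sum_(0 <= j < #|I'|) (stair j)%:R
  + \sum_(j in J') ((bstair j)%:R - (stair (#|I'| + j))%:R)
  + \sum_(i in I') (weight i)%:R :> R.
Proof.
rewrite starE sumrN; congr (_ + _ + _).
  by apply: eq_bigr => j _; ring.
by rewrite -sumrN; apply: eq_bigr => j _; ring.
Qed.

Let star_dualE' I' J' : star I' J' violator = hyper violator
  + \sum_(j in (~: J')%SET) ((stair (#|I'| + j))%:R - (bstair j)%:R)
  + \sum_(#|I'| + m <= j < n + m) (stair j)%:R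
  - \sum_(i in (~: I')%SET) (weight i)%:R :> R.
Proof.
rewrite star_dualE sumrN opprK; congr (_ + _ + _ + _).
  by apply: eq_bigr => j _; ring.
by rewrite -sumrN; apply: eq_bigr => j _; ring.
Qed.

Lemma stair_prefix k' : (k' < k)%N -> \sum_(0 <= j < k') (stair j)%:R = 0 :> R.
Proof.
move=> lt_k; rewrite big_nat_cond big1 // => j /andP[/andP[_ lt_j] _].
by rewrite /stair ifT //; lia.
Qed.

Lemma stair_prefix_mid : \sum_(0 <= j < k) (stair j)%:R = 1 :> R.
Proof.
case kE : k k_gt0 => [//|k'] _; rewrite big_nat_recr //= stair_prefix ?kE // add0r.
by rewrite /stair kE ltnn leqnn.
Qed.

Lemma stair_suffix k' : (k < k')%N ->
  \sum_(k' + m <= j < n + m) (stair j)%:R = ((n - k') * m.*2.+2)%:R :> R.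
Proof.
move=> lt_k; rewrite -natr_sum; congr _%:R.
rewrite -(subnDr m) -sum_nat_const_nat; apply: eq_big_nat => j /andP[le_j _].
by rewrite /stair; repeat case: ifP; lia.
Qed.

Lemma weight_in : \sum_(i in I) (weight i)%:R = #|J|%:R :> R.
Proof.
rewrite (bigD1 i0) //= big1 ?addr0 => [|i /andP[Ii ne]].
  by rewrite /weight indicE Ii0 eqxx.
by rewrite /weight indicE Ii ifN.
Qed.

Lemma weight_out : \sum_(i in (~: I)%SET) (weight i)%:R
  = ((n - k) * m.*2.+2)%:R - (m%:R - #|J|%:R) :> R.
Proof.
rewrite -card_setC (eq_bigr (fun i => (m.*2.+2)%:R
    + (if i == i1 then #|J|%:R - m%:R else 0))) => [|i]; last first.
  rewrite inE /weight indicE => /negbTE ->; rewrite -val_eqE.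
  case: ifP => _; last by rewrite addr0.
  by rewrite natrD -addnn -[m.+2]addn2 -[(m + m).+2]addn2 !natrD; ring.
rewrite big_split sumr_const (bigD1 i1) ?inE //= eqxx big1 => [|i /andP[_ /negbTE -> //]].
by rewrite mulnC natrM mulr_natr; ring.
Qed.

Lemma violator_star : star I J violator = - 1.
Proof.
rewrite starE' stair_prefix_mid weight_in (eq_bigr (fun=> - 1)) => [|j Jj].
  by rewrite sumr_const mulNrn; ring.
by rewrite stair_mid // indicE Jj.
Qed.

(** The direct and the dual form of (star) at (I, J) evaluate independently of
    the hyperplane, and differ by its equation. *)
Lemma violator_hyper : hyper violator = 0.
Proof.
have := violator_star; rewrite star_dualE' weight_out.
rewrite (eq_bigr (fun=> - 1)) => [|j]; last first.
  by rewrite inE => nJj; rewrite -opprB stair_mid // indicE (negbTE nJj).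
rewrite sumr_const card_setC.
rewrite big_ltn ?ltn_add2r // -addSn stair_suffix //.
have -> : stair (k + m) = m.*2.+1 by rewrite /stair; repeat case: ifP; lia.
have -> : (n - k = (n - k.+1).+1)%N by lia.
rewrite mulSn natrD mulNrn natrB //.
have -> : (m.*2.+2)%:R = (m.*2.+1)%:R + 1 :> R by rewrite -natr1.
by lra.
Qed.

Lemma weight_le i : (weight i <= m.*2.+2)%N.
Proof. by rewrite /weight; repeat case: ifP; lia. Qed.

Lemma weight_outside i : i \notin I -> (m.+2 + #|J| <= weight i)%N.
Proof. by move=> /negbTE nIi; rewrite /weight indicE nIi; case: ifP; lia. Qed.

Lemma violator_outer (o : outer_index n m) : outer_essential o ->
  0 <= ineq_form R (inr o) violator.
Proof.
move=> oE; rewrite ineq_form_outerE ?violator_hyper //.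
case: o oE => [[j|j]|[[j j']|[j j']]] /=; rewrite opprK addrC subr_ge0 ler_nat.
- by move=> _; rewrite -[X in (stair X <= _)%N]add0n stair_low.
- by move=> _; rewrite stair_high.
- by case/and3P => _ _ /eqP ->; rewrite stair_mono.
- by case/andP => _ /eqP ->; rewrite /bstair; repeat case: ifP; lia.
Qed.

(** The value at (I, J') is one less than the size of the symmetric difference of
    J and J'. Any other I' of size k contains an element outside of I, whose
    weight makes the value nonnegative. *)
Lemma violator_inner I' J' : (I', J') != (I, J) -> 0 <= star I' J' violator.
Proof.
move=> ne; have [lt_k|lt_k|eq_k] := ltngtP #|I'| k.
- rewrite starE' stair_prefix // oppr0 add0r addr_ge0 ?sumr_ge0 // => j _.
  by rewrite subr_ge0 ler_nat stair_low.
- rewrite star_dualE' violator_hyper add0r stair_suffix // -addrA addr_ge0 //.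
    by rewrite sumr_ge0 // => j _; rewrite subr_ge0 ler_nat stair_high.
  rewrite -card_setC subr_ge0 -natr_sum ler_nat -sum_nat_const.
  by apply: leq_sum => i _; apply: weight_le.
rewrite starE' eq_k stair_prefix_mid.
rewrite (eq_bigr (fun j : 'I_m => if j \in J then - 1 else 1)) => [|j _]; last first.
  by rewrite stair_mid // indicE.
have [II|nII] := eqVneq I' I.
  rewrite II weight_in -sumr_const [X in _ + X + _]big_mkcond [X in _ + _ + X]big_mkcond.
  have {}ne : J' != J by apply: contraNneq ne => ->; rewrite II.
  have [j jP] : exists j, (j \in J') != (j \in J).
    apply/existsP; apply: contraNT ne; rewrite negb_exists => /forallP ne.
    by apply/eqP/setP => j; apply/eqP; rewrite -[_ == _]negbK.
  (* Termwise: index i contributes 1 if it is in exactly one of J', J, else 0. *)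
  rewrite -addrA -big_split (bigD1 j) //= addrA addr_ge0 //.
    by move: jP; case: (j \in J'); case: (j \in J) => //= _; lra.
  rewrite sumr_ge0 // => i _.
  by case: (i \in J'); case: (i \in J) => //=; lra.
have [i I'i nIi] : exists2 i, i \in I' & i \notin I.
  apply/subsetPn; apply: contra nII => sub; by rewrite eqEcard sub eq_k leqnn.
have -> : - 1 + \sum_(j in J') (if j \in J then - 1 else 1) + \sum_(i in I') (weight i)%:R
  = (\sum_(j in J') (if j \in J then - 1 else 1) + m%:R)
  + (\sum_(i in I') (weight i)%:R - (m.+1)%:R) :> R.
  by rewrite -[m.+1]addn1 natrD; ring.
rewrite addr_ge0 //.
  have -> : m%:R = \sum_(j < m) 1 :> R by rewrite sumr_const card_ord.
  rewrite [X in X + _]big_mkcond -big_split sumr_ge0 // => j _ /=.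
  by case: (j \in J'); case: (j \in J); lra.
rewrite subr_ge0 -natr_sum ler_nat (bigD1 i) //=.
by have := weight_outside nIi; lia.
Qed.
End InnerWitness.

Section Irredundance.
Variables (R : realType) (n m : nat).
Hypothesis n_gt0 : (0 < n)%N.
Local Notation hyper := (@star R n m [set: 'I_n] [set: 'I_m]).

Lemma facet_form_irredundant (t : facet_index n m) : exists q,
  [/\ hyper q = 0, facet_form R t q < 0
    & forall u, u != t -> 0 <= facet_form R u q].
Proof.
case: t => [[[I J]|o] tE]; last first.
  have [q [hq qo qt]] := outer_witness R n_gt0 tE.
  by exists q; split=> // -[u uE] ne; apply: qt.
have /andP[I_gt0 lt_In] : (0 < #|I| < n)%N := tE.
have [i0 Ii0] : exists i, i \in I by apply/card_gt0P.
have [i1 Ii1] : exists i, i \in (~: I)%SET.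
  by apply/card_gt0P; rewrite card_setC subn_gt0.
rewrite inE in Ii1.
exists (violator R I J i0 i1); split; first exact: violator_hyper.
  have -> : facet_form R (exist _ (inl (I, J)) tE) (violator R I J i0 i1) = - 1.
    exact: violator_star.
  by rewrite ltrN10.
move=> [[[I' J']|o] uE] ne; last exact: violator_outer.
by apply: violator_inner.
Qed.
End Irredundance.

(** * Facets and their number *)

Section Counting.
Variables (n m : nat).
Hypothesis n_gt0 : (0 < n)%N.

Lemma sum_succ_pairs N :
  (\sum_(jj : 'I_N * 'I_N) (jj.2 == jj.1.+1 :> nat) = N.-1)%N.
Proof.
rewrite -(pair_bigA _ (fun j j' : 'I_N => nat_of_bool (j' == j.+1 :> nat))) /=.
rewrite (eq_bigr (fun j : 'I_N => nat_of_bool (j.+1 < N)%N)) => [|j _].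
  case: N => [|N]; first by rewrite big_ord0.
  rewrite big_ord_recr /= ltnn addn0 (eq_bigr (fun=> 1%N)).
    by rewrite sum1_card card_ord.
  by move=> j _; rewrite /= ltnS ltn_ord.
have [lt_j|le_j] := ltnP j.+1 N.
  rewrite (bigD1 (Ordinal lt_j)) //= eqxx big1 // => j' ne.
  by case: eqP => // jE; case/eqP: ne; apply: val_inj.
by rewrite big1 // => j' _; rewrite ltn_eqF // (leq_trans (ltn_ord j')).
Qed.

Lemma sum_inner_sets : (\sum_(I : {set 'I_n}) (0 < #|I| < n)%N = 2 ^ n - 2)%N.
Proof.
have : (\sum_(I : {set 'I_n}) ((0 < #|I| < n)%N + (I == finset.set0) + (I == [set: 'I_n]%SET))
    = 2 ^ n)%N.
  rewrite (eq_bigr (fun=> 1%N)) => [|I _].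
    by rewrite sum1_card -cardsT -powersetT card_powerset cardsT card_ord.
  have -> : (I == [set: 'I_n]%SET) = (#|I| == n).
    rewrite eqEcard finset.subsetT cardsT card_ord /= eqn_leq andb_idl // => _.
    by rewrite -[leqRHS]card_ord max_card.
  rewrite -cards_eq0; have : (#|I| <= n)%N by rewrite -[leqRHS]card_ord max_card.
  by move: #|I| => k; lia.
rewrite !big_split /= => <-.
have sum1 (A : {set 'I_n}) : (\sum_(I : {set 'I_n}) (I == A) = 1)%N.
  by rewrite (bigD1 A) //= eqxx big1 // => I /negbTE ->.
by rewrite !sum1; lia.
Qed.

Lemma card_facet_index : #|{: facet_index n m}| =
  ((2 ^ n - 2) * 2 ^ m + (m.*2 + ((if (1 < n) && (2 < n + m) then (n + m).-1 else 0)
     + (if 1 < n then m.-1 else 0))))%N.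
Proof.
rewrite card_sig -sum1_card big_mkcond /= big_sumType /=; congr addn.
  rewrite -(pair_bigA _ (fun (I : {set 'I_n}) (J : {set 'I_m}) =>
     if (0 < #|I| < n)%N then 1%N else 0%N)) /=.
  rewrite -sum_inner_sets big_distrl /=; apply: eq_bigr => I _.
  rewrite sum_nat_const -cardsT -powersetT card_powerset cardsT card_ord mulnC.
  by case: ifP.
rewrite !big_sumType /= !sum_nat_const card_ord !muln1 addnn; congr (_ + (_ + _))%N.
  have [n2|] := boolP ((1 < n) && (2 < n + m))%N.
    rewrite -[RHS]sum_succ_pairs; apply: eq_bigr => -[j j'] _; rewrite inE /=.
    by case/andP: n2 => -> ->; case: eqP.
  move=> nn; rewrite big1 // => -[j j'] _.
  by rewrite inE /= andbA (negbTE nn).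
have [n2|nn] := boolP (1 < n)%N.
  rewrite -[RHS]sum_succ_pairs; apply: eq_bigr => -[j j'] _.
  by rewrite inE /= n2; case: eqP.
by rewrite big1 // => -[j j'] _; rewrite inE /= (negbTE nn).
Qed.
End Counting.

Section Facets.
Variables (R : realType) (n m : nat).
Hypothesis n_gt0 : (0 < n)%N.
Local Arguments star : simpl never.
Local Notation B := (@boundary_cone R n m).
Local Notation hyper := (@star R n m [set: 'I_n] [set: 'I_m]).
Local Notation face t := (equality_set B (@facet_form R n m t)).
Implicit Types (I : {set 'I_n}) (J : {set 'I_m}) (t : facet_index n m).

Lemma face_determines_facet t : determines_facet B (@facet_form R n m t).
Proof.
rewrite boundary_coneE //; apply: polycone_determines_facet.
  exact: interior_point.
exact: facet_form_irredundant.
Qed.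

Lemma face_inj t u : face t `<=` face u -> t = u.
Proof.
rewrite boundary_coneE //; apply: equality_set_inj.
  exact: interior_point.
exact: facet_form_irredundant.
Qed.

Lemma facet_is_face F : is_facet B F -> exists t, F = face t.
Proof.
rewrite boundary_coneE //; apply: polycone_facet; exact: interior_point.
Qed.

Lemma face_is_facet t : is_facet B (face t).
Proof. by case: (face_determines_facet t). Qed.

Lemma facets_card : [set F | is_facet B F] #= `I_#|{: facet_index n m}|.
Proof.
pose f (i : 'I_#|{: facet_index n m}|) := face (enum_val i).
have -> : [set F | is_facet B F] = f @` [set: 'I_#|{: facet_index n m}|].
  apply/seteqP; split=> F /=; last by move=> [i _ <-]; apply: face_is_facet.
  move=> /facet_is_face[t ->]; exists (enum_rank t) => //.
  by rewrite /f enum_rankK.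
apply: card_eq_trans (_ : [set: 'I_#|{: facet_index n m}|] #= _).
  apply: inj_card_eq => i j _ _ fE; apply: enum_val_inj; apply: face_inj.
  by rewrite -/(f i) fE.
by rewrite card_eq_sym card_II.
Qed.

(** If a sum of facet inequalities is tight, then so are all its terms, so a
    nontrivial sum cannot determine a facet; the empty sum is tight also at
    interior points. *)
Lemma sum_facet_card1 (f : 'I_m -> facet_index n m) (A : {set 'I_m}) (g : bspace R n m -> R) t :
  injective f ->
  (forall p, B p -> g p = \sum_(j in A) facet_form R (f j) p) ->
  equality_set B g = face t -> #|A| = 1%N.
Proof.
move=> f_inj gE gt.
have f_ge0 j p : B p -> 0 <= facet_form R (f j) p.
  by case: (face_determines_facet (f j)) => ge0 _; apply: ge0.
have tE j : j \in A -> t = f j.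
  move=> Aj; apply: face_inj; rewrite -gt => p [Bp]; rewrite gE // => /eqP.
  rewrite psumr_eq0 => [/allP/(_ j (mem_index_enum _))|i _]; last exact: f_ge0.
  by rewrite Aj => /eqP.
have [A0|/card_gt0P[j Aj]] := posnP #|A|; last first.
  apply/eqP/cards1P; exists j; apply/setP => i; rewrite inE.
  apply/idP/eqP => [Ai|->//]; apply: f_inj.
  by rewrite -(tE _ Ai) (tE _ Aj).
have [p [hp pt]] := interior_point R m n_gt0.
have Bp : B p by rewrite boundary_coneE //; split=> // u; apply: ltW.
have : equality_set B g p by split=> //; rewrite gE // (cards0_eq A0) big_set0.
by rewrite gt => -[_ p0]; have := pt t; rewrite p0 ltxx.
Qed.

Definition inner_index I J (IE : (0 < #|I| < n)%N) : facet_index n m :=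
  exist _ (inl (I, J) : ineq_index n m) IE.
Definition low_index (j : 'I_m) : facet_index n m :=
  exist _ (inr (inl (inl j)) : ineq_index n m) isT.
Definition high_index (j : 'I_m) : facet_index n m :=
  exist _ (inr (inl (inr j)) : ineq_index n m) isT.

Definition star_of t : option ({set 'I_n} * {set 'I_m}) :=
  match val t with
  | inl IJ => Some IJ
  | inr (inl (inl j)) => Some (finset.set0, [set j]%SET)
  | inr (inl (inr j)) => Some ([set: 'I_n]%SET, (~: [set j])%SET)
  | inr (inr _) => None
  end.

Lemma star_ofE t I J : star_of t = Some (I, J) -> facet_form R t = star I J :> (_ -> _).
Proof.
case: t => -[[I' J']|[[j|j]|[jj|jj]]] tE; rewrite /star_of //= => -[].
- by move=> -> ->.
- by move=> <- <-.
- by move=> <- <-.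
Qed.

Lemma star_index I J :
  [\/ #|I| <> 0%N /\ #|I| <> n, #|I| = 0%N /\ #|J| = 1%N | #|I| = n /\ (#|J| + 1)%N = m] ->
  exists t, star_of t = Some (I, J).
Proof.
have le_In : (#|I| <= n)%N by rewrite -[leqRHS]card_ord max_card.
case=> [[I0 In]|[I0 J1]|[In Jm]].
- have IE : (0 < #|I| < n)%N.
    by rewrite lt0n ltn_neqAle le_In andbT; apply/andP; split; apply/eqP.
  by exists (inner_index J IE).
- have /cards1P[j ->] : #|J| == 1%N by rewrite J1.
  by exists (low_index j); rewrite (cards0_eq I0).
- have /cards1P[j jE] : #|(~: J)%SET| == 1%N by rewrite card_setC; lia.
  exists (high_index j); rewrite /star_of /= -jE finset.setCK; congr (Some (_, _)).
  by apply/eqP; rewrite eq_sym eqEcard finset.subsetT cardsT card_ord In leqnn.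
Qed.

Lemma star_facet_index I J : determines_facet B (@star R n m I J) ->
  exists t, star_of t = Some (I, J).
Proof.
move=> [_ /facet_is_face[t tE]]; apply: star_index.
have [I0|I0] := eqVneq #|I| 0%N.
  apply: Or32; split=> //; apply: (sum_facet_card1 (f := low_index) _ _ tE).
    by move=> j j' [].
  move=> p _; have [x [b [mu [nu ->]]]] := mkpoint_surj p.
  rewrite (cards0_eq I0) star_set0E; apply: eq_bigr => j _.
  by rewrite /facet_form [RHS]star_set0E big_set1.
have [In|In] := eqVneq #|I| n; last by apply: Or31; split; apply/eqP.
apply: Or33; split=> //.
suff : #|(~: J)%SET| = 1%N.
  rewrite card_setC; have : (#|J| <= m)%N by rewrite -[leqRHS]card_ord max_card.
  by lia.
have IT : I = [set: 'I_n]%SET.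
  by apply/eqP; rewrite eqEcard finset.subsetT cardsT card_ord In leqnn.
apply: (sum_facet_card1 (f := high_index) _ _ tE); first by move=> j j' [].
move=> p; rewrite boundary_coneE // => -[]; have [x [b [mu [nu ->]]]] := mkpoint_surj p.
move=> hp _; rewrite IT star_setTE hp add0r; apply: eq_bigr => j _.
by rewrite /facet_form [RHS]star_setTE hp add0r finset.setCK big_set1.
Qed.

Lemma star_of_determines_facet t I J : star_of t = Some (I, J) ->
  determines_facet B (@star R n m I J).
Proof. by move=> /star_ofE <-; apply: face_determines_facet. Qed.

Lemma star_of_cases t I J : star_of t = Some (I, J) ->
  (0 < #|I| + #|J| < n + m)%N /\
  [\/ #|I| <> 0%N /\ #|I| <> n, #|I| = 0%N /\ #|J| = 1%N | #|I| = n /\ (#|J| + 1)%N = m].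
Proof.
have le_Jm (K : {set 'I_m}) : (#|K| <= m)%N by rewrite -[leqRHS]card_ord max_card.
case: t => -[[I' J']|[[j|j]|[jj|jj]]] tE; rewrite /star_of //= => -[] <- <-.
- have /andP[I0 In] := tE; have := le_Jm J'; split; first by simpl in *; lia.
  by apply: Or31; split; simpl in *; lia.
- have := ltn_ord j => lt_j; rewrite cards0 cards1; split; first by lia.
  by apply: Or32.
- have := ltn_ord j => lt_j; rewrite cardsT card_ord card_setC cards1.
  by split; [|apply: Or33; split=> //]; lia.
Qed.

End Facets.

Lemma chamber_index_big n m (t : facet_index n m) :
  star_of t = None -> ~ (n = 1%N \/ (n = 2%N /\ m = 0%N)).
Proof.
case: t => -[[I J]|[[j|j]|[[j j']|[j j']]]] tE; rewrite /star_of //= => _.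
  by move: tE => /= /and3P[]; lia.
by move: tE => /= /andP[]; have := ltn_ord j; lia.
Qed.

Theorem theorem3 (R : realType) (n m : nat) (hn : (1 <= n)%N) :
  let B : set (bspace R n m) := @boundary_cone R n m in
  let star_facet (F : set (bspace R n m)) : Prop :=
    exists (I : {set 'I_n}) (J : {set 'I_m}),
      determines_facet B (@star R n m I J) /\
      F = equality_set B (@star R n m I J) in
  let chamber_set (F : set (bspace R n m)) : Prop :=
    (exists j j' : 'I_(n + m), j' = j.+1 :> nat /\
       F = equality_set B (@chamber R n m j j')) \/
    (exists j j' : 'I_m, j' = j.+1 :> nat /\
       F = equality_set B (@bchamber R n m j j')) in
  [/\ forall (I : {set 'I_n}) (J : {set 'I_m}),
        determines_facet B (@star R n m I J) <->
        (0 < #|I| + #|J| < n + m)%N /\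
        [\/ #|I| <> 0%N /\ #|I| <> n,
            #|I| = 0%N /\ #|J| = 1%N |
            #|I| = n /\ (#|J| + 1)%N = m],
      forall (I I' : {set 'I_n}) (J J' : {set 'I_m}),
        determines_facet B (@star R n m I J) ->
        determines_facet B (@star R n m I' J') ->
        equality_set B (@star R n m I J) = equality_set B (@star R n m I' J') ->
        I = I' /\ J = J',
      (n = 1%N \/ (n = 2%N /\ m = 0%N)) ->
        forall F, is_facet B F -> star_facet F,
      ~ (n = 1%N \/ (n = 2%N /\ m = 0%N)) ->
        [/\ forall j j' : 'I_(n + m), j' = j.+1 :> nat ->
              determines_facet B (@chamber R n m j j'),
            forall j j' : 'I_m, j' = j.+1 :> nat ->
              determines_facet B (@bchamber R n m j j') &
            forall F, (is_facet B F /\ ~ star_facet F) <-> chamber_set F] &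
      [/\ (2 <= n)%N -> ((1 <= m)%N \/ n = 2%N) ->
            [set F | is_facet B F] #=
              `I_((2 ^ n - 2) * 2 ^ m + n + 4 * m - 2)%N,
          (3 <= n)%N -> m = 0%N ->
            [set F | is_facet B F] #= `I_(2 ^ n - 2 + (n - 1))%N &
          n = 1%N -> [set F | is_facet B F] #= `I_(2 * m)%N]].
Proof.
move=> B star_facet chamber_set.
have starP I J : determines_facet B (@star R n m I J) <->
    (0 < #|I| + #|J| < n + m)%N /\
    [\/ #|I| <> 0%N /\ #|I| <> n, #|I| = 0%N /\ #|J| = 1%N | #|I| = n /\ (#|J| + 1)%N = m].
  split; first by move=> /(star_facet_index hn)[t]; apply: star_of_cases.
  by move=> [_ IJ]; have [t tE] := star_index hn IJ; apply: star_of_determines_facet tE.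
have face_star t I J : star_of t = Some (I, J) -> star_facet (equality_set B (facet_form R t)).
  move=> tE; exists I, J; split; first exact: star_of_determines_facet tE.
  by rewrite (star_ofE R tE).
have face_chamber t : star_of t = None -> chamber_set (equality_set B (facet_form R t)).
  case: t => -[[I J]|[[j|j]|[[j j']|[j j']]]] tE; rewrite /star_of //= => _.
    by left; exists j, j'; split=> //; move: tE => /= /and3P[_ _ /eqP].
  by right; exists j, j'; split=> //; move: tE => /= /andP[_ /eqP].
have chamber_face F : ~ (n = 1%N \/ (n = 2%N /\ m = 0%N)) -> chamber_set F ->
    exists2 t, star_of t = None & F = equality_set B (facet_form R t).
  move=> big [] [j [j' [jE ->]]].
    have tE : essential (inr (inr (inl (j, j'))) : ineq_index n m).
      by rewrite /= jE eqxx andbT; lia.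
    by exists (exist (fun t : ineq_index n m => is_true (essential t)) _ tE).
  have tE : essential (inr (inr (inr (j, j'))) : ineq_index n m).
    by rewrite /= jE eqxx andbT; lia.
  by exists (exist (fun t : ineq_index n m => is_true (essential t)) _ tE).
split.
- exact: starP.
- move=> I I' J J' /(star_facet_index hn)[t tE] /(star_facet_index hn)[t' t'E].
  rewrite -(star_ofE R tE) -(star_ofE R t'E) => ff.
  have tt' : t = t' by apply: (face_inj (R := R) hn); rewrite ff.
  by move: t'E; rewrite -tt' tE => -[-> ->].
- move=> small F /(facet_is_face hn)[t ->].
  by case tE : (star_of t) => [[I J]|]; [apply: face_star tE | case: (chamber_index_big tE small)].
- move=> big; split.
  + move=> j j' jE.
    have tE : essential (inr (inr (inl (j, j'))) : ineq_index n m).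
      by rewrite /= jE eqxx andbT; lia.
    exact: (face_determines_facet R hn
      (exist (fun t : ineq_index n m => is_true (essential t)) _ tE)).
  + move=> j j' jE.
    have tE : essential (inr (inr (inr (j, j'))) : ineq_index n m).
      by rewrite /= jE eqxx andbT; lia.
    exact: (face_determines_facet R hn
      (exist (fun t : ineq_index n m => is_true (essential t)) _ tE)).
  + move=> F; split=> [[/(facet_is_face hn)[t ->] nstar]|].
      case tE : (star_of t) => [[I J]|]; last exact: face_chamber.
      by case: nstar; apply: face_star tE.
    move=> /(chamber_face _ big)[t tE ->]; split; first exact: face_is_facet.
    move=> [I [J [/(star_facet_index hn)[u uE]]]]; rewrite -(star_ofE R uE) => ff.
    have tu : t = u by apply: (face_inj (R := R) hn); rewrite ff.
    by rewrite tu uE in tE.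
have cardE N : #|{: facet_index n m}| = N -> [set F | is_facet B F] #= `I_N.
  by move=> <-; apply: facets_card.
split.
- move=> n2 big; apply: cardE; rewrite card_facet_index // n2 /=.
  case: ifP => [nm|/negbT nm].
    by move: ((2 ^ n - 2) * 2 ^ m)%N => K; lia.
  have [-> ->] : n = 2%N /\ m = 0%N by lia.
  by [].
- move=> n3 m0; apply: cardE; rewrite card_facet_index // m0 addn0.
  by rewrite n3 (ltnW n3) expn0 muln1 /=; move: (2 ^ n - 2)%N => K; lia.
- by move=> n1; apply: cardE; rewrite card_facet_index // n1 /=; lia.
Qed.
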